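(* Let $\phi:\mathbb{Q}_2\to\mathbb{C}$ be the characteristic function of the unit disc ($\phi(x)=1$ if $|x|_2\le1$, $0$ otherwise) and $\psi^{(0)}(x)=\phi(\tfrac{1}{2}x)-\phi(\tfrac{1}{2}x-\tfrac12)$. Let $s\in\mathbb{N}$ and $\alpha_0,\dots,\alpha_{2^s-1}\in\mathbb{C}$, and define $$\psi^{(s)}(x)=\sum_{k=0}^{2^s-1}\alpha_k\,\psi^{(0)}\Big(x+\frac{k}{2^s}\Big),\qquad x\in\mathbb{Q}_2,$$ where $\frac{k}{2^s}$ denotes the $2$-adic number $2^{-s}(k_0+k_12+\cdots+k_{s-1}2^{s-1})$ with $k=k_0+k_12+\cdots+k_{s-1}2^{s-1}$, $k_i\in\{0,1\}$. Then $\psi^{(s)}$ is a wavelet function, i.e. the system $\{2^{-\gamma/2}\psi^{(s)}(2^{\gamma}x-a):\gamma\in\mathbb{Z},\ a\in I_2\}$ is an orthonormal basis of $\mathcal{L}^2(\mathbb{Q}_2)$, if and only if there exist $\gamma_0,\dots,\gamma_{2^s-1}\in\mathbb{C}$ with $|\gamma_r|=1$ for all $r$ such that $$\alpha_k=2^{-s}(-1)^k\sum_{r=0}^{2^s-1}\gamma_r\,e^{-i\pi\frac{2r+1}{2^s}k},\qquad k=0,1,\dots,2^s-1.$$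
   Context: $\mathbb{Q}_2$ is the field of $2$-adic numbers with $2$-adic norm $|\cdot|_2$ and Haar measure $dx$ normalized so that the unit disc $\mathbb{Z}_2=\{|x|_2\le 1\}$ has measure $1$; $\mathcal{L}^2(\mathbb{Q}_2)$ is taken with respect to this measure. $I_2$ denotes the set of $2$-adic numbers of the form $a=2^{-\gamma}(a_0+a_1 2+\cdots+a_{\gamma-1}2^{\gamma-1})$ with $\gamma\in\mathbb{N}$ and $a_i\in\{0,1\}$ (a set of representatives of $\mathbb{Q}_2/\mathbb{Z}_2$, including $0$). *)

(* Defs.v *)
From HB Require Import structures.
From mathcomp Require Import all_boot all_order all_algebra.
From mathcomp Require Import complex.
From mathcomp Require Import all_classical all_reals all_analysis.
From mathcomp Require Import zify ring lra.
Set Implicit Arguments.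
Unset Strict Implicit.
Unset Printing Implicit Defensive.
Import Order.TTheory GRing.Theory Num.Theory numFieldNormedType.Exports.
Local Open Scope quotient_scope.
Local Open Scope classical_set_scope.
Local Open Scope ring_scope.

(* |q|_2 = 2 ^ (- v_2(q)), on rationals. *)
Definition abs2 (q : rat) : rat :=
  if q == 0 then 0
  else 2 ^ ((logn 2 `|denq q|%N)%:Z - (logn 2 `|numq q|%N)%:Z).

Lemma abs2_0 : abs2 0 = 0.
Proof. by rewrite /abs2 eqxx. Qed.

Lemma abs2_gt0 q : q != 0 -> 0 < abs2 q.
Proof. by move=> q0; rewrite /abs2 (negPf q0) exprz_gt0. Qed.

Lemma abs2_ge0 q : 0 <= abs2 q.
Proof. by have [->|/abs2_gt0/ltW//] := eqVneq q 0; rewrite abs2_0. Qed.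

Lemma abs2_eq0 q : (abs2 q == 0) = (q == 0).
Proof.
have [->|q0] := eqVneq q 0; first by rewrite abs2_0 eqxx.
by rewrite gt_eqF// abs2_gt0.
Qed.

Lemma abs2_ratio (a b : int) : a != 0 -> b != 0 ->
  abs2 (a%:Q / b%:Q) = 2 ^ ((logn 2 `|b|%N)%:Z - (logn 2 `|a|%N)%:Z).
Proof.
move=> a0 b0; set q := _ / _.
have aQ0 : a%:Q != 0 by rewrite intr_eq0.
have bQ0 : b%:Q != 0 by rewrite intr_eq0.
have q0 : q != 0 by rewrite mulf_neq0// invr_eq0.
rewrite /abs2 (negPf q0); congr (_ ^ _).
have e : a * denq q = numq q * b.
  apply/eqP; rewrite -(eqr_int rat) !intrM.
  have dQ0 : (denq q)%:Q != 0 by rewrite intr_eq0 denq_neq0.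
  by rewrite -eqr_div// -/q divq_num_den.
have := congr1 (fun z : int => logn 2 `|z|%N) e.
rewrite !abszM !lognM ?absz_gt0 ?denq_neq0 ?numq_eq0// => ?.
by lia.
Qed.

Lemma abs2_1 : abs2 1 = 1.
Proof. by have := @abs2_ratio 1 1 isT isT; rewrite divr1 subrr expr0z. Qed.

Lemma abs2N q : abs2 (- q) = abs2 q.
Proof. by rewrite /abs2 oppr_eq0 numqN denqN abszN. Qed.

Lemma abs2M p q : abs2 (p * q) = abs2 p * abs2 q.
Proof.
have [->|p0] := eqVneq p 0; first by rewrite mul0r abs2_0 mul0r.
have [->|q0] := eqVneq q 0; first by rewrite mulr0 abs2_0 mulr0.
rewrite -[p]divq_num_den -[q]divq_num_den mulf_div -!intrM.
rewrite !abs2_ratio ?mulf_neq0 ?denq_neq0 ?numq_eq0//.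
rewrite -expfzDr// !abszM !lognM ?absz_gt0 ?denq_neq0 ?numq_eq0//.
by congr (_ ^ _); lia.
Qed.

Lemma abs2V q : abs2 q^-1 = (abs2 q)^-1.
Proof.
have [->|q0] := eqVneq q 0; first by rewrite invr0 abs2_0.
apply: (mulIf (x := abs2 q)); first by rewrite abs2_eq0.
by rewrite -abs2M !mulVf ?abs2_1// abs2_eq0.
Qed.

Lemma abs2_int (n : int) : abs2 n%:Q <= 1.
Proof.
have [->|n0] := eqVneq n 0; first by rewrite abs2_0.
have := @abs2_ratio n 1 n0 isT; rewrite divr1 => ->.
by rewrite logn1 sub0r -exprnN invf_le1 ?exprn_gt0// exprn_ege1.
Qed.

Lemma abs2D1 q : abs2 q <= 1 -> abs2 (1 + q) <= 1.
Proof.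
have [->|q0 q1] := eqVneq q 0; first by rewrite addr0 abs2_1.
have d0 : (denq q)%:Q != 0 by rewrite intr_eq0 denq_neq0.
have d1 : abs2 (denq q)%:Q = 1.
  have := @abs2_ratio (denq q) 1 (denq_neq0 q) isT; rewrite divr1 => ->.
  rewrite logn1 sub0r.
  suff -> : logn 2 `|denq q| = 0%N by [].
  move: q1; rewrite /abs2 (negPf q0).
  have [dvd|ndvd] := boolP (2 %| `|denq q|)%N; last first.
    by move=> _; apply/eqP; rewrite -leqn0 leqNgt logn_gt0 mem_primes/= absz_gt0 denq_neq0.
  have ndvd : ~~ (2 %| `|numq q|)%N.
    apply/negP => dvd'; have := dvdn_gcd 2 `|numq q| `|denq q|.
    by rewrite dvd dvd' (eqP (coprime_num_den q)).
  have -> : logn 2 `|numq q| = 0%N.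
    by apply/eqP; rewrite -leqn0 leqNgt logn_gt0 mem_primes/= absz_gt0 numq_eq0 q0.
  case: (logn 2 `|denq q|) => // n.
  by rewrite subr0 leNgt -exprnP exprn_egt1.
have -> : 1 + q = (denq q + numq q)%:Q / (denq q)%:Q.
  by rewrite intrD mulrDl divff// divq_num_den.
by rewrite abs2M abs2V d1 invr1 mulr1 abs2_int.
Qed.

Lemma abs2D p q : abs2 (p + q) <= Num.max (abs2 p) (abs2 q).
Proof.
wlog pq : p q / abs2 q <= abs2 p.
  by move=> h; case/orP: (le_total (abs2 q) (abs2 p)) => /h//; rewrite addrC maxC.
rewrite max_l//.
have [p0|p0] := eqVneq p 0.
  move: pq; rewrite p0 abs2_0 add0r; exact.
have -> : p + q = p * (1 + q / p) by field.
rewrite abs2M ger_pMr ?abs2_gt0// abs2D1// abs2M abs2V.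
by rewrite ler_pdivrMr ?abs2_gt0// mul1r.
Qed.

Lemma abs2B p q : abs2 (p - q) <= Num.max (abs2 p) (abs2 q).
Proof. by rewrite -(abs2N q) abs2D. Qed.

Lemma abs2D_lt e p q : abs2 p < e -> abs2 q < e -> abs2 (p + q) < e.
Proof. by move=> pe qe; rewrite (le_lt_trans (abs2D _ _))// gt_max pe. Qed.

Definition cauchy2 : {pred nat -> rat} := fun u =>
  `[< forall e : rat, 0 < e -> exists N : nat, forall m n : nat,
      (N <= m)%N -> (N <= n)%N -> abs2 (u m - u n) < e >].

Lemma cauchy2P u : reflect (forall e : rat, 0 < e -> exists N : nat,
  forall m n : nat, (N <= m)%N -> (N <= n)%N -> abs2 (u m - u n) < e)
  (u \in cauchy2).
Proof. exact: asboolP. Qed.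

Lemma cauchy2_bounded u : u \in cauchy2 ->
  exists2 M : rat, 0 < M & forall n, abs2 (u n) <= M.
Proof.
move/cauchy2P/(_ 1 ltr01) => [N uN].
pose M := 1 + \sum_(i < N.+1) abs2 (u i).
have le n : (n <= N)%N -> abs2 (u n) <= M.
  move=> nN; rewrite /M (bigD1 (inord n : 'I_N.+1))//= inordK//.
  rewrite addrCA lerDl addr_ge0// sumr_ge0// => i _; exact: abs2_ge0.
exists M => [|n].
  rewrite ltr_wpDr// sumr_ge0// => i _; exact: abs2_ge0.
have [/le//|/ltnW Nn] := leqP n N.
rewrite -[u n](subrK (u N)) (le_trans (abs2D _ _))// ge_max le// andbT.
rewrite (le_trans (ltW (uN _ _ Nn (leqnn _))))// lerDl sumr_ge0// => i _.
exact: abs2_ge0.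
Qed.

Lemma cauchy2_subring : subring_closed cauchy2.
Proof.
split.
- apply/cauchy2P => e e0; exists 0%N => m n _ _.
  by rewrite subrr abs2_0.
- move=> u v /cauchy2P cu /cauchy2P cv; apply/cauchy2P => e e0.
  have [N uN] := cu e e0; have [N' vN] := cv e e0.
  exists (maxn N N') => m n; rewrite !geq_max => /andP[? ?] /andP[? ?].
  have -> : (u - v) m - (u - v) n = (u m - u n) - (v m - v n).
    by rewrite !fctE; ring.
  by apply: abs2D_lt; rewrite ?abs2N; [exact: uN|exact: vN].
- move=> u v uc vc; have [M M0 uM] := cauchy2_bounded uc.
  have [M' M'0 vM] := cauchy2_bounded vc.
  move: uc vc => /cauchy2P cu /cauchy2P cv; apply/cauchy2P => e e0.
  have [N uN] := cu (e / M') (divr_gt0 e0 M'0).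
  have [N' vN] := cv (e / M) (divr_gt0 e0 M0).
  exists (maxn N N') => m n; rewrite !geq_max => /andP[? ?] /andP[? ?].
  have -> : (u * v) m - (u * v) n = u m * (v m - v n) + (u m - u n) * v n.
    by rewrite !fctE; ring.
  apply: abs2D_lt; rewrite abs2M.
  + rewrite (le_lt_trans (ler_wpM2r (abs2_ge0 _) (uM _)))//.
    by rewrite mulrC -ltr_pdivlMr// vN.
  + rewrite (le_lt_trans (ler_wpM2l (abs2_ge0 _) (vM _)))//.
    by rewrite -ltr_pdivlMr// uN.
Qed.

HB.instance Definition _ :=
  GRing.isSubringClosed.Build (nat -> rat) cauchy2 cauchy2_subring.

Record cseq := CSeq { cseq_val :> nat -> rat; cseqP : cseq_val \in cauchy2 }.
HB.instance Definition _ := [isSub for cseq_val].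
HB.instance Definition _ := [Choice of cseq by <:].
HB.instance Definition _ := [SubChoice_isSubComNzRing of cseq by <:].

Definition null2 : {pred cseq} := fun u =>
  `[< forall e : rat, 0 < e -> exists N : nat, forall n : nat,
      (N <= n)%N -> abs2 (u n) < e >].

Lemma null2P (u : cseq) : reflect (forall e : rat, 0 < e -> exists N : nat,
  forall n : nat, (N <= n)%N -> abs2 (u n) < e) (u \in null2).
Proof. exact: asboolP. Qed.

Lemma null2_ideal : idealr_closed null2.
Proof.
split.
- by apply/null2P => e e0; exists 0%N => n _; rewrite abs2_0.
- apply/negP => /null2P /(_ 1 ltr01)[N /(_ N (leqnn _))].
  by rewrite abs2_1 ltxx.
- move=> a u v /null2P un /null2P vn; apply/null2P => e e0.
  have [M M0 aM] := cauchy2_bounded (cseqP a).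
  have [N uN] := un (e / M) (divr_gt0 e0 M0); have [N' vN] := vn e e0.
  exists (maxn N N') => n; rewrite geq_max => /andP[? ?].
  apply: abs2D_lt; last exact: vN.
  rewrite abs2M (le_lt_trans (ler_wpM2r (abs2_ge0 _) (aM _)))//.
  by rewrite mulrC -ltr_pdivlMr// uN.
Qed.

HB.instance Definition _ :=
  isProperIdeal.Build cseq null2 (idealr_closed_nontrivial null2_ideal).
HB.instance Definition _ :=
  GRing.isZmodClosed.Build cseq null2 (idealr_closedB null2_ideal).

(* Q_2 is the completion of (rat, |.|_2): the ring cseq of 2-adic Cauchy
   sequences of rationals modulo the ideal null2 of null sequences. *)
Definition Q2 : Type := {ideal_quot null2}.
HB.instance Definition _ := GRing.ComNzRing.on Q2.
HB.instance Definition _ := NzRingQuotient.on Q2.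

Lemma Q2_eqE (u v : cseq) : (\pi_Q2 u == \pi_Q2 v) = (u - v \in null2).
Proof. by rewrite Quotient.idealrBE. Qed.

Lemma not_null2 (u : cseq) : u \notin null2 ->
  exists2 e : rat, 0 < e &
  exists N : nat, forall n : nat, (N <= n)%N -> e <= abs2 (u n).
Proof.
move/negP => nu; have [e [e0 ue]] : exists e : rat, 0 < e /\
    forall N : nat, exists2 n : nat, (N <= n)%N & e <= abs2 (u n).
  apply: contrapT => h; apply: nu; apply/null2P => e e0.
  apply: contrapT => h'; apply: h; exists e; split=> // N.
  apply: contrapT => h''; apply: h'; exists N => n Nn.
  by rewrite ltNge; apply/negP => ?; apply: h''; exists n.
exists e => //; have /cauchy2P/(_ e e0)[N uN] := cseqP u.
exists N => n Nn; rewrite leNgt; apply/negP => une.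
have [m Nm] := ue N; rewrite leNgt => /negP; apply.
by rewrite -[u m](subrK (u n)) abs2D_lt// uN.
Qed.

Lemma cauchy2V (u : cseq) : u \notin null2 -> (fun n => (u n)^-1) \in cauchy2.
Proof.
move=> /not_null2[d d0 [N ud]]; apply/cauchy2P => e e0.
have /cauchy2P/(_ (e * d ^+ 2))[|N' uN'] := cseqP u.
  by rewrite mulr_gt0 ?exprn_gt0.
exists (maxn N N') => m n; rewrite !geq_max => /andP[? ?] /andP[? ?].
have um0 : 0 < abs2 (u m) by rewrite (lt_le_trans d0)// ud.
have un0 : 0 < abs2 (u n) by rewrite (lt_le_trans d0)// ud.
have -> : (u m)^-1 - (u n)^-1 = (u n - u m) / (u m * u n).
  move: um0 un0; generalize (u m) (u n) => a b a0 b0.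
  have a_neq0 : a != 0 by rewrite -abs2_eq0 gt_eqF.
  have b_neq0 : b != 0 by rewrite -abs2_eq0 gt_eqF.
  by field; rewrite a_neq0 b_neq0.
rewrite abs2M abs2V abs2M ltr_pdivrMr ?mulr_gt0// (lt_le_trans (uN' _ _ _ _))//.
by rewrite ler_pM2l// expr2 ler_pM// ?ud// ltW.
Qed.

(* insubd falls back to 0 when the pointwise inverse is not Cauchy, which does
   not happen when x != 0 (cauchy2V). *)
Definition invQ2 (x : Q2) : Q2 :=
  if x == 0 then 0 else \pi_Q2 (insubd (0 : cseq) (fun n => (repr x n)^-1)).

Lemma invQ2_0 : invQ2 0 = 0.
Proof. by rewrite /invQ2 eqxx. Qed.

Lemma mulVQ2 (x : Q2) : x != 0 -> invQ2 x * x = 1.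
Proof.
move=> x0; rewrite /invQ2 (negPf x0) -{2}[x]reprK.
have xN : repr x \notin null2.
  apply: contra x0; rewrite -[repr x]subr0 -Q2_eqE reprK => /eqP ->.
  by rewrite rmorph0.
rewrite -rmorphM/= -(rmorph1 \pi_Q2); apply/eqP; rewrite Q2_eqE.
have [d d0 [N xd]] := not_null2 xN; apply/null2P => e e0; exists N => n Nn.
rewrite /= insubdK; last exact: cauchy2V.
rewrite !fctE mulVf ?subrr ?abs2_0//.
by rewrite -abs2_eq0 gt_eqF// (lt_le_trans d0)// xd.
Qed.

HB.instance Definition _ := GRing.ComNzRing_isField.Build Q2 mulVQ2 invQ2_0.

(* The 2-adic norm takes its values in {0} and the integral powers of 2, hence
   it is rat-valued; rat^o carries the usual (archimedean) topology of rat.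
   The limit exists and does not depend on the representative (cvg_norm2). *)
Definition norm2 (x : Q2) : rat :=
  lim ((fun n => abs2 (repr x n) : rat^o) @ \oo).

Lemma abs2_isosceles p q : abs2 (p - q) < abs2 q -> abs2 p = abs2 q.
Proof.
move=> pq; apply/eqP; rewrite eq_le; apply/andP; split.
  by rewrite -[p](subrK q) (le_trans (abs2D _ _))// ge_max (ltW pq) lexx.
rewrite leNgt; apply/negP => pq'.
rewrite -abs2N opprB in pq.
by have := abs2D_lt pq' pq; rewrite addrC subrK ltxx.
Qed.

Lemma cvg_norm2 (u : cseq) :
  (fun n => abs2 (u n) : rat^o) @ \oo --> (norm2 (\pi_Q2 u) : rat^o).
Proof.
set v := repr (\pi_Q2 u).
have uv : u - v \in null2 by rewrite -Q2_eqE reprK.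
suff [l ul vl] : exists2 l : rat, (fun n => abs2 (u n) : rat^o) @ \oo --> (l : rat^o)
    & (fun n => abs2 (v n) : rat^o) @ \oo --> (l : rat^o).
  rewrite /norm2 (cvg_lim _ vl)//; exact: norm_hausdorff.
have null0 (w : cseq) : w \in null2 ->
    (fun n => abs2 (w n) : rat^o) @ \oo --> (0 : rat^o).
  move=> /null2P w0; apply/cvgrPdist_lt => e e0; have [N wN] := w0 e e0.
  exists N => // n /= Nn; rewrite sub0r normrN ger0_norm ?abs2_ge0//; exact: wN.
have [un|un] := boolP (u \in null2).
  exists 0; first exact: null0.
  by apply: null0; rewrite -[v](subrK u) rpredD// -opprB rpredN.
have [d d0 [N ud]] := not_null2 un.
have /cauchy2P/(_ d d0)[M uM] := cseqP u.
have /null2P/(_ d d0)[P uvP] := uv.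
pose K := maxn N (maxn M P); exists (abs2 (u K)).
  apply: (@cvg_near_cst _ _ (abs2 (u K) : rat^o)); exists K => // n /=.
  rewrite /K !geq_max => /and3P[? ? ?]; apply/esym/abs2_isosceles.
  by rewrite (lt_le_trans (uM _ _ _ _) (ud _ _))// leq_max leq_max leqnn ?orbT.
apply: (@cvg_near_cst _ _ (abs2 (u K) : rat^o)); exists K => // n /=.
rewrite /K !geq_max => /and3P[? ? ?].
have -> : abs2 (u K) = abs2 (u n).
  apply/abs2_isosceles.
  by rewrite (lt_le_trans (uM _ _ _ _) (ud _ _))// leq_max leq_max leqnn ?orbT.
apply/abs2_isosceles; rewrite -abs2N opprB.
exact: (lt_le_trans (uvP n _) (ud n _)).
Qed.

Definition open2 (U : set Q2) : Prop :=
  forall x, U x -> exists2 r : rat, 0 < r & [set y | norm2 (y - x) < r] `<=` U.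

Lemma open2T : open2 setT.
Proof. by move=> x _; exists 1. Qed.

Lemma open2I : setI_closed open2.
Proof.
move=> U V oU oV x [Ux Vx].
have [r r0 rU] := oU x Ux; have [t t0 tV] := oV x Vx.
exists (Num.min r t); first by rewrite lt_min r0.
by move=> y /=; rewrite lt_min => /andP[yr yt]; split; [exact: rU|exact: tV].
Qed.

Lemma open2_bigU (I : Type) (U : I -> set Q2) :
  (forall i, open2 (U i)) -> open2 (\bigcup_i U i).
Proof.
move=> oU x [i _ Uix]; have [r r0 rU] := oU i x Uix.
by exists r => // y /rU; exists i.
Qed.

HB.instance Definition _ := isPointed.Build Q2 0.
HB.instance Definition _ :=
  isOpenTopological.Build Q2 open2T open2I open2_bigU.

(* Q_2 with its Borel sigma-algebra; the topology is the one induced by norm2. *)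
Notation borelQ2 := (g_sigma_algebraType (@open Q2)).

(* The Haar measure of (Q_2, +) normalized by mu(Z_2) = 1; these two properties
   determine mu on Borel sets. *)
Definition is_haar (R : realType) (mu : {measure set borelQ2 -> \bar R}) : Prop :=
  (forall (a : Q2) (A : set Q2), measurable (A : set borelQ2) ->
    mu [set a + x | x in A] = mu A) /\
  mu [set x : Q2 | norm2 x <= 1] = 1%E.

(* Complex-valued L^2(mu): elements are represented by functions, so equality
   in L^2 is equality up to L2norm 0. *)
Section ComplexL2.
Context d (T : measurableType d) (R : realType).
Variable mu : {measure set T -> \bar R}.
Implicit Types f g : T -> R[i].

Definition L2norm f : \bar R := Lnorm mu 2%:E (fun x => (Normc.normc (f x))%:E).

Definition L2 f : Prop :=
  [/\ measurable_fun setT (fun x => complex.Re (f x)),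
      measurable_fun setT (fun x => complex.Im (f x)) &
      (L2norm f < +oo)%E].

Definition L2dot f g : R[i] :=
  Complex (\int[mu]_x complex.Re (f x * (g x)^*))
          (\int[mu]_x complex.Im (f x * (g x)^*)).

Definition orthonormal_system (I : eqType) (D : set I) (e : I -> T -> R[i]) : Prop :=
  (forall i, D i -> L2 (e i)) /\
  (forall i j, D i -> D j -> L2dot (e i) (e j) = (i == j)%:R).

(* The finite linear combinations of (e i), D i, are dense in L^2(mu). *)
Definition total_system (I : eqType) (D : set I) (e : I -> T -> R[i]) : Prop :=
  forall f, L2 f -> forall eps : R, 0 < eps ->
    exists (s : seq I) (c : I -> R[i]), (forall i, i \in s -> D i) /\
      (L2norm (fun x => f x - \sum_(i <- s) c i * e i x)%R < eps%:E)%E.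

Definition orthonormal_basis (I : eqType) (D : set I) (e : I -> T -> R[i]) : Prop :=
  orthonormal_system D e /\ total_system D e.

End ComplexL2.

Section Wavelets.
Variable R : realType.
Implicit Types psi : Q2 -> R[i].

Definition I2 : set Q2 :=
  [set a | exists (g : nat) (b : 'I_g -> bool),
     a = (\sum_(i < g) (b i)%:R * 2 ^+ i) / 2 ^+ g].

(* j = (gamma, a) indexes x |-> 2^(-gamma/2) psi(2^gamma x - a). *)
Definition dilate_shift psi (j : int * Q2) : Q2 -> R[i] :=
  fun x => (2 `^ (- j.1%:~R / 2))%:C%C * psi (2 ^ j.1 * x - j.2).

Definition is_wavelet (mu : {measure set borelQ2 -> \bar R}) psi : Prop :=
  orthonormal_basis mu [set j : int * Q2 | I2 j.2] (dilate_shift psi).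

(* phi is the indicator of the unit disc Z_2. *)
Definition phi (x : Q2) : R[i] := if norm2 x <= 1 then 1 else 0.

Definition psi0 (x : Q2) : R[i] := phi (x / 2) - phi (x / 2 - 1 / 2).

Definition psi_s (s : nat) (alpha : 'I_(2 ^ s) -> R[i]) (x : Q2) : R[i] :=
  \sum_(k < 2 ^ s) alpha k * psi0 (x + (k : nat)%:R / 2 ^+ s).

(* e^(i t) for real t *)
Definition cis (t : R) : R[i] := Complex (cos t) (sin t).

End Wavelets.

(* Main.v *)
(* The translates and dilates of the Haar function psi0 are orthonormal, because
   psi0 is a character of Z_2 (with values 1 on 2 Z_2 and -1 on 1 + 2 Z_2)
   extended by 0. Translation by 2^(-s) acts on the span of the 2^s functions
   psi0 (x + k / 2^s) as an operator T with T^(2^s) = -1, hence with eigenvalues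
   the 2^s-th roots of -1. On this span the Gram matrix of the translates of psi_s
   is diagonalized by the discrete Fourier transform attached to these roots, and
   its eigenvalues are the |A_r|^2, where A is the transform of alpha. So the
   system is orthonormal iff all |A_r| = 1, and inverting the transform gives the
   formula for alpha with gamma = A. When |A_r| = 1 for all r, psi0 is
   recovered as a combination of translates of psi_s, so that totality reduces to
   that of the Haar functions. For these, halving repeatedly gives
   1_B = (Haar functions) + 2^(-n) 1_(B_n), where B_n is a ball of measure
   2^n mu(B), so the last term tends to 0 in L^2; balls then generate everything
   by a pi-lambda argument. *)
Require Import Defs.
From HB Require Import structures.
From mathcomp Require Import all_boot all_order all_algebra.
From mathcomp Require Import complex.
From mathcomp Require Import all_classical all_reals all_analysis.
From mathcomp Require Import measurable_realfun zify ring lra.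
Set Implicit Arguments.
Unset Strict Implicit.
Unset Printing Implicit Defensive.
Import Order.TTheory GRing.Theory Num.Theory numFieldNormedType.Exports.
Local Open Scope quotient_scope.
Local Open Scope classical_set_scope.
Local Open Scope ring_scope.

(** * The norm and the unit disc of Q_2 *)

Lemma norm2_lim (u : cseq) (l : rat) :
  (fun n => abs2 (u n) : rat^o) @ \oo --> (l : rat^o) -> norm2 (\pi_Q2 u) = l.
Proof.
have hT : hausdorff_space rat^o by exact: norm_hausdorff.
by move=> ul; rewrite -(cvg_lim hT ul); apply/esym/(cvg_lim hT)/cvg_norm2.
Qed.

Lemma norm2_null2 (u : cseq) : u \in null2 -> norm2 (\pi_Q2 u) = 0.
Proof.
move=> /null2P u0; apply: norm2_lim; apply/cvgrPdist_lt => e e0; have [N uN] := u0 e e0.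
exists N => // n /= Nn; rewrite sub0r normrN ger0_norm ?abs2_ge0//; exact: uN.
Qed.

(** A Cauchy sequence that is not null stays away from 0, so its consecutive differences eventually
    become smaller than its terms. By the isosceles property its absolute values are then constant:
    the limit is attained. *)
Lemma norm2_near (u : cseq) : u \notin null2 ->
  exists N : nat, forall n : nat, (N <= n)%N -> abs2 (u n) = norm2 (\pi_Q2 u).
Proof.
move=> /not_null2[d d0 [N ud]].
have /cauchy2P/(_ d d0)[M uM] := cseqP u.
pose K := maxn N M; have uK n : (K <= n)%N -> abs2 (u n) = abs2 (u K).
  rewrite geq_max => /andP[Nn Mn]; apply/abs2_isosceles.
  by rewrite (lt_le_trans (uM _ _ _ _) (ud _ _)) ?leq_maxl ?leq_maxr.
exists K => n /uK ->; apply/esym/norm2_lim.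
by apply: (@cvg_near_cst _ _ (abs2 (u K) : rat^o)); exists K.
Qed.

(** For a null class the zero sequence is taken as representative. So the norm is attained termwise
    in all cases, and inequalities for [abs2] pass to [norm2] term by term. *)
Lemma norm2_repr (x : Q2) : exists2 u : cseq, x = \pi_Q2 u &
  exists N : nat, forall n : nat, (N <= n)%N -> abs2 (u n) = norm2 x.
Proof.
rewrite -[x]reprK; have [x0|x0] := boolP (repr x \in null2); last first.
  by exists (repr x) => //; exact: norm2_near.
exists 0; last by exists 0%N => n _; rewrite norm2_null2// abs2_0.
by apply/eqP; rewrite Q2_eqE subr0.
Qed.

Lemma norm2_le (u : cseq) (r : rat) : 0 <= r ->
  (exists N : nat, forall n : nat, (N <= n)%N -> abs2 (u n) <= r) ->
  norm2 (\pi_Q2 u) <= r.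
Proof.
move=> r0 [N uN]; have [/norm2_null2 -> //|/norm2_near[M uM]] := boolP (u \in null2).
by rewrite -(uM (maxn N M)) ?leq_maxr// uN// leq_maxl.
Qed.

Lemma norm2_ge0 x : 0 <= norm2 x.
Proof. by have [u _ [N /(_ N (leqnn _)) <-]] := norm2_repr x; exact: abs2_ge0. Qed.

Lemma norm2D x y r : norm2 x <= r -> norm2 y <= r -> norm2 (x + y) <= r.
Proof.
move=> xr yr; have r0 : 0 <= r by exact: le_trans (norm2_ge0 x) xr.
have [u ux [N uN]] := norm2_repr x; have [v vy [M vM]] := norm2_repr y.
rewrite {1}ux {1}vy -rmorphD/=; apply: norm2_le => //; exists (maxn N M) => n.
rewrite geq_max => /andP[Nn Mn].
by rewrite (le_trans (abs2D (u n) (v n)))// ge_max uN// vM// xr yr.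
Qed.

Lemma norm2N x : norm2 (- x) = norm2 x.
Proof.
suff le y : norm2 (- y) <= norm2 y by apply/eqP; rewrite eq_le le -{1}[x]opprK le.
have [u uy [N uN]] := norm2_repr y; rewrite {1}uy -rmorphN/=.
by apply: norm2_le; [exact: norm2_ge0|exists N => n Nn; rewrite abs2N uN].
Qed.

Lemma norm2M_le x y : norm2 (x * y) <= norm2 x * norm2 y.
Proof.
have [u ux [N uN]] := norm2_repr x; have [v vy [M vM]] := norm2_repr y.
rewrite {1}ux {1}vy -rmorphM/=; apply: norm2_le; first by rewrite mulr_ge0 ?norm2_ge0.
exists (maxn N M) => n; rewrite geq_max => /andP[Nn Mn].
by rewrite abs2M uN// vM.
Qed.

(** * Rational numbers inside Q_2 *)

Lemma const_cauchy2 (q : rat) : (fun=> q) \in cauchy2.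
Proof. by apply/cauchy2P => e e0; exists 0%N => *; rewrite subrr abs2_0. Qed.

Definition ratQ2 (q : rat) : Q2 := \pi_Q2 (CSeq (const_cauchy2 q)).

Lemma ratQ2_is_additive : zmod_morphism ratQ2.
Proof.
move=> p q; rewrite /ratQ2 -rmorphB; congr (\pi_Q2 _).
exact/val_inj.
Qed.

Lemma ratQ2_is_multiplicative : monoid_morphism ratQ2.
Proof.
split=> [|p q]; rewrite /ratQ2; first rewrite -(rmorph1 \pi_Q2).
  by congr (\pi_Q2 _); exact/val_inj.
by rewrite -rmorphM; congr (\pi_Q2 _); exact/val_inj.
Qed.

HB.instance Definition _ :=
  GRing.isZmodMorphism.Build rat Q2 ratQ2 ratQ2_is_additive.
HB.instance Definition _ :=
  GRing.isMonoidMorphism.Build rat Q2 ratQ2 ratQ2_is_multiplicative.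

Lemma norm2_ratE q : norm2 (ratQ2 q) = abs2 q.
Proof.
have [q0|/norm2_near[N /(_ N (leqnn _)) //]] := boolP (CSeq (const_cauchy2 q) \in null2).
rewrite norm2_null2//; apply/esym/eqP/contraT => q_neq0.
have q_gt0 : 0 < abs2 q by rewrite lt0r q_neq0 abs2_ge0.
by have /null2P/(_ _ q_gt0)[N /(_ N (leqnn _))] := q0; rewrite ltxx.
Qed.

Lemma norm2_rat_dense x e : 0 < e -> exists q, norm2 (x - ratQ2 q) <= e.
Proof.
move=> e0; have [u -> _] := norm2_repr x.
have /cauchy2P/(_ e e0)[N uN] := cseqP u.
exists (u N); rewrite -rmorphB/=; apply: norm2_le; first exact: ltW.
by exists N => n Nn; rewrite ltW// uN.
Qed.

(* Locked, as unifying two instances would otherwise unfold the quotient Q2. *)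
HB.lock Definition Z2 (x : Q2) : bool := norm2 x <= 1.
Canonical Z2_unlockable := Unlockable Z2.unlock.

Lemma Z2E x : Z2 x = (norm2 x <= 1). Proof. by rewrite unlock. Qed.

Lemma ratQ2_nat n : ratQ2 n%:R = n%:R. Proof. exact: rmorph_nat. Qed.

Lemma norm2_nat n : norm2 n%:R = abs2 n%:R.
Proof. by rewrite -ratQ2_nat norm2_ratE. Qed.

Lemma Z2D x y : Z2 x -> Z2 y -> Z2 (x + y). Proof. rewrite !unlock; exact: norm2D. Qed.
Lemma Z2N x : Z2 (- x) = Z2 x. Proof. by rewrite !unlock norm2N. Qed.
Lemma Z2B x y : Z2 x -> Z2 y -> Z2 (x - y).
Proof. by move=> Zx Zy; rewrite Z2D ?Z2N. Qed.
Lemma Z2DB x y : Z2 y -> Z2 (x + y) = Z2 x.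
Proof.
by move=> Zy; apply/idP/idP => [|Zx]; [rewrite -{2}[x](addrK y) => /Z2B->|exact: Z2D].
Qed.
Lemma Z2M x y : Z2 x -> Z2 y -> Z2 (x * y).
Proof.
by rewrite !unlock => Zx Zy; rewrite (le_trans (norm2M_le _ _))// mulr_ile1 ?norm2_ge0.
Qed.
Lemma Z2_nat n : Z2 n%:R.
Proof. by rewrite unlock norm2_nat; exact: (abs2_int n). Qed.
Lemma Z2X x n : Z2 x -> Z2 (x ^+ n).
Proof. by move=> Zx; elim: n => [|n IH]; rewrite ?expr0 ?(Z2_nat 1)// exprS Z2M. Qed.

Lemma abs2_2 : abs2 2 = 1 / 2.
Proof. by have := @abs2_ratio 2 1 isT isT; rewrite divr1 => ->. Qed.

Lemma Q2_2_neq0 : (2 : Q2) != 0.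
Proof. by apply/eqP => /(congr1 norm2); rewrite norm2_nat abs2_2 (norm2_nat 0) abs2_0. Qed.

Lemma nZ2_half : ~~ Z2 (1 / 2).
Proof.
have -> : 1 / 2 = ratQ2 (1 / 2) by rewrite fmorph_div rmorph1 rmorph_nat.
by rewrite unlock norm2_ratE abs2M abs2V abs2_2 abs2_1.
Qed.


(** * Residues modulo 2 *)

Lemma odd_denq q : abs2 q <= 1 -> odd `|denq q|.
Proof.
have [->|q0] := eqVneq q 0; first by [].
rewrite /abs2 (negPf q0); apply: contraLR; rewrite -dvdn2 => dvd.
have ndvd : ~~ (2 %| `|numq q|)%N.
  apply/negP => dvd'; have := dvdn_gcd 2 `|numq q| `|denq q|.
  by rewrite dvd dvd' (eqP (coprime_num_den q)).
have -> : logn 2 `|numq q| = 0%N.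
  by apply/eqP; rewrite -leqn0 leqNgt logn_gt0 mem_primes/= absz_gt0 numq_eq0 q0.
have : (0 < logn 2 `|denq q|)%N.
  by rewrite logn_gt0 mem_primes/= absz_gt0 denq_neq0.
case: (logn 2 `|denq q|) => // n _.
by rewrite subr0 -ltNge -exprnP exprn_egt1.
Qed.

Lemma abs2_half (n d : int) : ~~ odd `|n| -> odd `|d| -> abs2 (n%:Q / d%:Q / 2) <= 1.
Proof.
move=> n_even d_odd.
have -> : n = 2 * (n %/ 2)%Z by lia.
have d0 : d != 0 by apply: contraTneq d_odd => ->.
have dQ0 : d%:Q != 0 by rewrite intr_eq0.
have -> : (2 * (n %/ 2)%Z)%:Q / d%:Q / 2 = (n %/ 2)%Z%:Q / d%:Q.
  by rewrite intrM; field.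
suff d1 : abs2 d%:Q = 1 by rewrite abs2M abs2V d1 invr1 mulr1 abs2_int.
have := @abs2_ratio d 1 d0 isT; rewrite divr1 => ->.
rewrite logn1 sub0r; suff -> : logn 2 `|d| = 0%N by [].
by apply/eqP; rewrite -leqn0 leqNgt logn_gt0 mem_primes/= dvdn2 d_odd andbF.
Qed.

(** The denominator is odd, so the parity of the numerator decides; for an odd numerator, [q - 1]
    has as numerator a difference of two odd numbers. *)
Lemma abs2_residue q : abs2 q <= 1 -> abs2 (q / 2) <= 1 \/ abs2 ((q - 1) / 2) <= 1.
Proof.
move=> /odd_denq dodd; have [nodd|neven] := boolP (odd `|numq q|); last first.
  by left; rewrite -[q]divq_num_den abs2_half.
right; have -> : q - 1 = (numq q - denq q)%:Q / (denq q)%:Q.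
  by rewrite intrB mulrBl divq_num_den divff// intr_eq0 denq_neq0.
by rewrite abs2_half//; lia.
Qed.

(** The residue field has two elements. A rational [q] within 1/2 of [x] has the same residue, which
    reduces the claim to [abs2_residue]. *)
Lemma Z2_residue x : Z2 x -> Z2 (x / 2) || Z2 ((x - 1) / 2).
Proof.
move=> Zx; have [q xq] := @norm2_rat_dense x (1 / 2) isT.
have xqZ : Z2 ((x - ratQ2 q) / 2).
  rewrite unlock (le_trans (norm2M_le _ _))//.
  have -> : (2^-1 : Q2) = ratQ2 (2^-1) by rewrite fmorphV rmorph_nat.
  by rewrite norm2_ratE abs2V abs2_2 -ler_pdivlMr.
have q1 : abs2 q <= 1.
  rewrite -norm2_ratE -[ratQ2 q](subKr x); apply: norm2D; first by rewrite -Z2E.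
  by rewrite norm2N (le_trans xq).
have [q2|q2] := abs2_residue q1; apply/orP; [left|right].
  have -> : x / 2 = (x - ratQ2 q) / 2 + ratQ2 (q / 2).
    by rewrite fmorph_div rmorph_nat; ring.
  by rewrite Z2D// unlock norm2_ratE.
have -> : (x - 1) / 2 = (x - ratQ2 q) / 2 + ratQ2 ((q - 1) / 2).
  by rewrite fmorph_div rmorphB rmorph1 rmorph_nat; ring.
by rewrite Z2D// unlock norm2_ratE.
Qed.

Lemma Z2_residue_excl x : Z2 (x / 2) -> ~~ Z2 ((x - 1) / 2).
Proof.
move=> Zx; apply/negP => /(Z2B Zx); apply/negP.
by rewrite -mulrBl opprB addrC subrK; exact: nZ2_half.
Qed.

Lemma Z2_double x : Z2 (x / 2) -> Z2 x.
Proof. by move=> /(Z2M (Z2_nat 2)); rewrite mulrCA divff ?Q2_2_neq0// mulr1. Qed.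

Lemma Z2_double1 x : Z2 ((x - 1) / 2) -> Z2 x.
Proof. by move=> /Z2_double; rewrite Z2DB// Z2N (Z2_nat 1). Qed.

Lemma divf_exprS (F : fieldType) (x y : F) g : y != 0 -> x / y = y ^+ g * (x / y ^+ g.+1).
Proof. by move=> y0; rewrite exprSr invfM mulrCA mulVKf ?expf_neq0. Qed.

Lemma divf_exprSM (F : fieldType) (x y : F) g : y != 0 -> x * y / y ^+ g.+1 = x / y ^+ g.
Proof. by move=> y0; rewrite exprSr -mulf_div divff// mulr1. Qed.

(** An odd [n] would make [n / 2], hence [1 / 2], a 2-adic integer; so a factor 2 can be cancelled
    and induction applies. *)
Lemma Z2_nat_divX n g : Z2 (n%:R / 2 ^+ g) -> (2 ^ g %| n)%N.
Proof.
elim: g n => [|g IH] n; first by rewrite expn0 dvd1n.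
have X0 : (2 : Q2) ^+ g != 0 by rewrite expf_neq0 ?Q2_2_neq0.
move=> Zn; have Zn2 : Z2 (n%:R / 2).
  by rewrite (divf_exprS _ g Q2_2_neq0) Z2M ?Z2X ?(Z2_nat 2).
have n_even : ~~ odd n.
  apply/negP => n_odd; have := nZ2_half; rewrite -(Z2DB _ (Z2_nat n./2)).
  by rewrite -{1}[n./2%:R](mulfK Q2_2_neq0) -mulrDl -natrM nat1r muln2 (_ : _.+1 = n) ?Zn2//; lia.
move: Zn; rewrite -[n]odd_double_half (negPf n_even) add0n -muln2 expnSr => Zn.
rewrite dvdn_pmul2r// IH//; by rewrite -(divf_exprSM _ g Q2_2_neq0) -natrM.
Qed.

Lemma norm2_exp2 n : norm2 (2 ^+ n) = (2 ^+ n)^-1.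
Proof.
have -> : 2 ^+ n = (2 ^ n)%:R :> Q2 by rewrite natrX.
rewrite norm2_nat; elim: n => [|n IH]; first by rewrite expn0 abs2_1 expr0 invr1.
by rewrite expnS natrM abs2M abs2_2 IH exprS invfM div1r.
Qed.

Lemma Z2_scale x : exists n : nat, Z2 (2 ^+ n * x).
Proof.
have [n xn] : exists n : nat, norm2 x <= 2 ^+ n.
  pose m := Num.bound (norm2 x); exists m.
  rewrite (le_trans (ltW (archi_boundP (norm2_ge0 x))))//.
  by rewrite -natrX ler_nat ltnW// ltn_expl.
exists n; rewrite unlock (le_trans (norm2M_le _ _))//.
by rewrite norm2_exp2 mulrC ler_pdivrMr ?mul1r ?exprn_gt0.
Qed.

(** * Representatives modulo Z_2 and the Haar function *)

Lemma Z2_0 : Z2 0. Proof. exact: (Z2_nat 0). Qed.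
Lemma Z2_1 : Z2 1. Proof. exact: (Z2_nat 1). Qed.

Lemma digit_shift (F : fieldType) (e x b : F) : (2 : F) != 0 -> e != 0 ->
  e * (x - b / (2 * e)) = (2 * e * x - b) / 2.
Proof. by move=> F2 e0; field; rewrite F2 e0. Qed.

Lemma digit_rest (F : fieldType) (e x b z : F) : (2 : F) != 0 -> e != 0 ->
  x - (b + 2 * z) / (2 * e) = x - b / (2 * e) - z / e.
Proof. by move=> F2 e0; field; rewrite F2 e0. Qed.

(** The lowest digit [b0] is the residue of [2 ^+ g.+1 * x] modulo 2; subtracting [b0 / 2 ^+ g.+1]
    leaves a number with one digit less. *)
Lemma Z2_digits g x : Z2 (2 ^+ g * x) ->
  exists b : 'I_g -> bool, Z2 (x - (\sum_(i < g) (b i)%:R * 2 ^+ i) / 2 ^+ g).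
Proof.
elim: g x => [|g IH] x Zx; last have X0 := expf_neq0 g Q2_2_neq0.
  by exists (fun=> true); rewrite big_ord0 mul0r subr0; rewrite expr0 mul1r in Zx.
have [b0 Zb0] : exists b0 : bool, Z2 ((2 ^+ g.+1 * x - b0%:R) / 2).
  by case/orP: (Z2_residue Zx) => ?; [exists false; rewrite subr0|exists true].
have [|b Zb] := IH (x - b0%:R / 2 ^+ g.+1).
  by rewrite exprS digit_shift ?Q2_2_neq0// -exprS.
exists (fun i => if unlift ord0 i is Some j then b j else b0).
rewrite big_ord_recl unlift_none expr0 mulr1.
under eq_bigr => i _ do rewrite liftK lift0 exprS mulrCA.
by rewrite -mulr_sumr exprS digit_rest ?Q2_2_neq0// -exprS.
Qed.

Lemma I2_repr x : exists2 a : Q2, I2 a & Z2 (x - a).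
Proof.
have [g /Z2_digits[b Zb]] := Z2_scale x.
by exists ((\sum_(i < g) (b i)%:R * 2 ^+ i) / 2 ^+ g) => //; exists g, b.
Qed.

Lemma I2_nat a : I2 a -> exists g n : nat, (n < 2 ^ g)%N /\ a = n%:R / 2 ^+ g.
Proof.
move=> [g [b ->]]; exists g, (\sum_(i < g) b i * 2 ^ i)%N; split; last first.
  congr (_ / _); rewrite natr_sum; apply: eq_bigr => i _.
  by rewrite natrM natrX.
elim: g b => [|g IH] b; first by rewrite big_ord0.
rewrite big_ord_recr/= expnS mul2n -addnn -addSn leq_add ?IH//.
by case: (b _); rewrite ?mul1n.
Qed.

Lemma divf_sub (F : fieldType) (m n e f : F) : e != 0 -> f != 0 ->
  m / e - n / f = (m * f - n * e) / (e * f).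
Proof. by move=> e0 f0; field; rewrite e0 f0. Qed.

(** Over the common denominator [2 ^ (g + h)] the difference has a numerator below that denominator,
    and integrality makes the numerator divisible by it, hence 0. Ordering the two fractions first
    makes the truncated subtraction a true one. *)
Lemma frac_uniq (m n g h : nat) : (m < 2 ^ g)%N -> (n < 2 ^ h)%N ->
  Z2 (m%:R / 2 ^+ g - n%:R / 2 ^+ h) -> m%:R / 2 ^+ g = n%:R / 2 ^+ h :> Q2.
Proof.
wlog le : m n g h / (n * 2 ^ g <= m * 2 ^ h)%N.
  move=> hwlog mg nh Zmn; have [|/ltnW] := leqP (n * 2 ^ g) (m * 2 ^ h) => le.
    exact: hwlog.
  by apply/esym/hwlog => //; rewrite -Z2N opprB.
move=> mg nh; have F2 := Q2_2_neq0.
have e : m%:R / 2 ^+ g - n%:R / 2 ^+ h =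
    (m * 2 ^ h - n * 2 ^ g)%N%:R / 2 ^+ (g + h) :> Q2.
  by rewrite divf_sub ?expf_neq0// -exprD natrB// !natrM !natrX.
rewrite e => /Z2_nat_divX; rewrite expnD => dvd.
have : (m * 2 ^ h - n * 2 ^ g < 2 ^ g * 2 ^ h)%N.
  by rewrite (leq_ltn_trans (leq_subr _ _))// ltn_pmul2r ?expn_gt0.
have [/eqP d0 _|d0] := posnP (m * 2 ^ h - n * 2 ^ g)%N.
  by apply/eqP; rewrite -subr_eq0 e (eqP d0) mul0r.
by rewrite ltnNge dvdn_leq.
Qed.

Lemma I2_uniq a b : I2 a -> I2 b -> Z2 (a - b) -> a = b.
Proof. by move=> /I2_nat[g [m [mg ->]]] /I2_nat[h [n [nh ->]]]; exact: frac_uniq. Qed.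

(** Instead of writing out the binary digits of [k], the representative of the fraction is taken and
    identified with it by uniqueness. *)
Lemma I2_frac s k : (k < 2 ^ s)%N -> I2 (k%:R / 2 ^+ s).
Proof.
move=> ks; have [a Ia] := I2_repr (k%:R / 2 ^+ s).
have [g [m [mg am]]] := I2_nat Ia; move: Ia; rewrite am => Ia.
by move/frac_uniq => ->.
Qed.

Lemma I2_0 : I2 0.
Proof. by have := @I2_frac 0 0 isT; rewrite mul0r. Qed.

Section Haar.
Variable R : realType.

(** The real-valued form of [psi0], so that real integration applies to it. *)
Definition haar (x : Q2) : R := (Z2 (x / 2))%:R - (Z2 ((x - 1) / 2))%:R.

Lemma psi0E x : psi0 R x = (haar x)%:C%C.
Proof.
by rewrite /psi0 /phi -mulrBl -!Z2E /haar rmorphB/= !rmorph_nat; do 2 case: ifP => _.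
Qed.

Lemma haarP x : [\/ ~~ Z2 x /\ haar x = 0, Z2 (x / 2) /\ haar x = 1 |
  Z2 ((x - 1) / 2) /\ haar x = -1].
Proof.
rewrite /haar; have [Zx|nZx] := boolP (Z2 (x / 2)).
  by rewrite (negPf (Z2_residue_excl Zx)) subr0; apply: Or32.
have [Zx|nZx'] := boolP (Z2 ((x - 1) / 2)); first by rewrite sub0r; apply: Or33.
rewrite subrr; apply: Or31; split => //.
by apply/negP => /Z2_residue; rewrite (negPf nZx) (negPf nZx').
Qed.

Lemma haar_even x : Z2 (x / 2) -> haar x = 1.
Proof. by move=> Zx; rewrite /haar Zx (negPf (Z2_residue_excl Zx)) subr0. Qed.

Lemma haar_odd x : Z2 ((x - 1) / 2) -> haar x = -1.
Proof.
move=> Zx; rewrite /haar Zx; have [/Z2_residue_excl|_] := boolP (Z2 (x / 2)).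
  by rewrite Zx.
by rewrite sub0r.
Qed.

Lemma haar_out x : ~~ Z2 x -> haar x = 0.
Proof.
by case: (haarP x) => [[]|[/Z2_double ->]|[/Z2_double1 ->]].
Qed.

Lemma haar0 : haar 0 = 1.
Proof. by rewrite haar_even// mul0r Z2_0. Qed.

(** The character property, by parity of [y] and [z]. It also holds for [y] outside Z_2, where
    translation by [z] does not enter Z_2 and both sides vanish. *)
Lemma haarD y z : Z2 z -> haar (y + z) = haar y * haar z.
Proof.
move=> Zz; have [[nZy ->]|[Zy ->]|[Zy ->]] := haarP y.
- by rewrite mul0r haar_out// Z2DB.
- have [[]|[Zz2 ->]|[Zz2 ->]] := haarP z; first by rewrite Zz.
    by rewrite mulr1 haar_even// mulrDl Z2D.
  by rewrite mul1r haar_odd// -addrA mulrDl Z2D.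
- have [[]|[Zz2 ->]|[Zz2 ->]] := haarP z; first by rewrite Zz.
    by rewrite mulr1 haar_odd// addrAC mulrDl Z2D.
  rewrite mulrNN mulr1 haar_even//.
  have -> : y + z = (y - 1) + (z - 1) + 2 by ring.
  by rewrite 2!mulrDl divff ?Q2_2_neq0// Z2D ?Z2_1// Z2D.
Qed.

Lemma haar_sqr x : haar x * haar x = (Z2 x)%:R.
Proof.
have [[/negPf -> ->]|[/Z2_double -> ->]|[/Z2_double1 -> ->]] := haarP x.
- by rewrite mulr0.
- by rewrite mulr1.
- by rewrite mulrNN mulr1.
Qed.

Lemma haarN x : haar (- x) = haar x.
Proof.
have [Zx|nZx] := boolP (Z2 x); last by rewrite !haar_out// Z2N.
have : haar x * haar x * haar (- x) = haar x.
  by rewrite -mulrA -haarD ?Z2N// subrr haar0 mulr1.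
by rewrite haar_sqr Zx mul1r.
Qed.

(** On the support of the first factor, [y - b'] is a translate of [b - b'] by the integer [y - b],
    so [haarD] produces the square of the first factor, an indicator. *)
Lemma haarM y b b' :
  haar (y - b) * haar (y - b') = haar (b - b') * (Z2 (y - b))%:R.
Proof.
have [Zy|nZy] := boolP (Z2 (y - b)); last by rewrite haar_out// mul0r mulr0.
have -> : y - b' = (b - b') + (y - b) by ring.
by rewrite (haarD (b - b') Zy) mulrCA haar_sqr Zy.
Qed.

Lemma haar_half x : (Z2 (x / 2))%:R = ((Z2 x)%:R + haar x) / 2.
Proof.
have [[/negPf nZx ->]|[Zx ->]|[Zx ->]] := haarP x.
- by rewrite nZx addr0 mul0r; case: (boolP (Z2 (x / 2))) => // /Z2_double; rewrite nZx.
- by rewrite Zx (Z2_double Zx) divff.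
- rewrite (Z2_double1 Zx) subrr mul0r; case: (boolP (Z2 (x / 2))) => // /Z2_residue_excl.
  by rewrite Zx.
Qed.

Lemma haar_frac s k l : (k < 2 ^ s)%N -> (l < 2 ^ s)%N ->
  haar (k%:R / 2 ^+ s - l%:R / 2 ^+ s) = (k == l)%:R.
Proof.
wlog lk : k l / (l <= k)%N.
  move=> hw ks ls; have [|/ltnW] := leqP l k => le; first exact: hw.
  by rewrite -haarN opprB hw// eq_sym.
move=> ks _; rewrite -mulrBl -natrB//; have [->|kl] := eqVneq k l.
  by rewrite subnn mul0r haar0.
apply: haar_out; apply/negP => /Z2_nat_divX /dvdn_leq; rewrite subn_gt0 ltn_neqAle.
by rewrite lk eq_sym kl leqNgt (leq_ltn_trans (leq_subr _ _) ks) => /(_ isT).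
Qed.

End Haar.

(** * The Fourier transform attached to the 2^s-th roots of -1 *)

Section Cis.
Variable R : realType.
Implicit Types t a b : R.

Lemma cisD a b : cis (a + b) = cis a * cis b.
Proof.
rewrite /cis cosD sinD; apply/eqP.
by rewrite eq_complex /= [X in _ && (X == _)]addrC !eqxx.
Qed.

Lemma cis0 : cis (0 : R) = 1.
Proof. by rewrite /cis cos0 sin0. Qed.

Lemma cisX a n : cis a ^+ n = cis (a * n%:R).
Proof.
elim: n => [|n IH]; first by rewrite expr0 mulr0 cis0.
by rewrite exprS IH -cisD -[in RHS]nat1r mulrDr mulr1.
Qed.

Lemma cis_conj t : (cis t)^* = cis (- t).
Proof. by rewrite /cis cosN sinN. Qed.

Lemma cispi : cis (pi : R) = -1.
Proof. by rewrite /cis cospi sinpi; apply/eqP; rewrite eq_complex/= oppr0 !eqxx. Qed.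

Lemma norm_cis t : `|cis t| = 1.
Proof. by rewrite normc_def/= cos2Dsin2 sqrtr1. Qed.

End Cis.

Lemma sum_expr_unity (F : fieldType) n (w : F) :
  w ^+ n = 1 -> w != 1 -> \sum_(k < n) w ^+ k = 0.
Proof.
move=> wn w1; have := subrX1 w n; rewrite wn subrr => /esym/eqP.
by rewrite mulf_eq0 subr_eq0 (negPf w1) => /eqP.
Qed.

Section DFT.
Variables (R : realType) (s : nat).
Local Notation N := (2 ^ s)%N.

(* The factor (-1) ^ [0 < s] replaces (-1) ^ k, with which it agrees for
   k < 2 ^ s, while (uroot r) ^ (2 ^ s) = -1 also holds for s = 0. *)
Definition uroot (r : nat) : R[i] :=
  (-1) ^+ (0 < s)%N * cis (- (pi * ((2 * r + 1)%N%:R / 2 ^+ s))).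

Definition zeta : R[i] := cis (- (pi / 2 ^+ s)).

Lemma zetaN : zeta ^+ N = -1.
Proof.
rewrite /zeta cisX -natrX mulNr mulfVK ?pnatr_eq0 -?lt0n ?expn_gt0//.
by rewrite -cis_conj cispi rmorphN rmorph1.
Qed.

(** The order of [zeta] divides [2 ^ s.+1] but not [2 ^ s], because [zeta ^+ N] is -1. *)
Lemma zeta_prim : (2 ^ s.+1).-primitive_root zeta.
Proof.
have z1 : zeta ^+ (2 ^ s.+1) = 1 by rewrite expnSr exprM zetaN expr2 mulrNN mulr1.
have [m mz mdvd] := prim_order_exists (expn_gt0 2 s.+1) z1.
have /(dvdn_pfactor _ _ (isT : prime 2))[j js me] := mdvd.
move: js; rewrite leq_eqVlt => /orP[/eqP je|]; first by rewrite -je -me.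
rewrite ltnS => js; have : zeta ^+ N = 1.
  apply/eqP; rewrite -(prim_order_dvd mz) me; exact: dvdn_exp2l.
rewrite zetaN => /eqP; rewrite eq_sym -addr_eq0.
by rewrite (_ : 1 + 1 = 2%:R)// pnatr_eq0.
Qed.

Lemma urootE r : uroot r = (-1) ^+ (0 < s)%N * zeta ^+ (2 * r + 1).
Proof. by rewrite /uroot /zeta cisX mulNr mulrAC -mulrA. Qed.

Lemma signN : ((-1) ^+ (0 < s)%N) ^+ N = 1 :> R[i].
Proof. by rewrite -exprM -signr_odd oddM oddX; case: (s). Qed.

Lemma urootN r : uroot r ^+ N = -1.
Proof.
rewrite urootE exprMn signN mul1r -exprM mulnC exprM zetaN.
by rewrite -signr_odd oddD oddM.
Qed.

Lemma norm_uroot r : `|uroot r| = 1.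
Proof. by rewrite normrM normrX normrN1 expr1n mul1r norm_cis. Qed.

Lemma urootV r : uroot r * (uroot r)^* = 1.
Proof. by rewrite -normCK norm_uroot expr1n. Qed.

Lemma uroot_inj (r q : 'I_N) : uroot r * (uroot q)^* = 1 -> r = q.
Proof.
move=> rq; have : uroot r = uroot q.
  by rewrite -[uroot r]mulr1 -(urootV q) mulrA mulrAC rq mul1r.
rewrite !urootE => /mulfI; rewrite signr_eq0 => /(_ isT)/eqP.
rewrite (eq_prim_root_expr zeta_prim) eqn_modDr expnS -!muln_modr eqn_pmul2l//.
by rewrite !modn_small// => /eqP/val_inj.
Qed.

(** For distinct indices the common ratio is a quotient of two different [N]-th roots of -1, that is
    an [N]-th root of unity other than 1, so the geometric sum vanishes. *)
Lemma uroot_row (r q : 'I_N) :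
  \sum_(k < N) (uroot r ^+ k * (uroot q)^* ^+ k) = N%:R * (r == q)%:R.
Proof.
under eq_bigr => k _ do rewrite -exprMn.
have [<-|rq] := eqVneq r q.
  under eq_bigr => k _ do rewrite urootV expr1n.
  by rewrite sumr_const card_ord mulr1.
rewrite mulr0 sum_expr_unity//; last by apply: contraNneq rq => /uroot_inj ->.
by rewrite exprMn -rmorphXn !urootN rmorphN rmorph1 mulrNN mulr1.
Qed.

(** Up to a fixed factor this is a geometric sum in [r] of ratio [zeta ^+ (2 * j)], an [N]-th root
    of unity, different from 1 when [0 < j < N]. *)
Lemma uroot_col j : (j < N)%N -> \sum_(r < N) uroot r ^+ j = N%:R * (j == 0)%N%:R.
Proof.
case: j => [_|j jN].
  under eq_bigr => r _ do rewrite expr0.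
  by rewrite sumr_const card_ord mulr1.
have urE (r : 'I_N) : uroot r ^+ j.+1 = uroot 0 ^+ j.+1 * (zeta ^+ (2 * j.+1)) ^+ r.
  rewrite !urootE !exprMn -mulrA; congr (_ * _).
  by rewrite -!exprM -exprD; congr (_ ^+ _); lia.
under eq_bigr => r _ do rewrite urE.
rewrite -mulr_sumr sum_expr_unity ?mulr0//.
  by rewrite -exprM mulnAC -expnS exprM (prim_expr_order zeta_prim) expr1n.
by rewrite -(prim_order_dvd zeta_prim) expnS dvdn_pmul2l// gtnNdvd.
Qed.

Lemma haar_add_frac (n m : nat) (x : Q2) : haar R (x + (N * n + m)%:R / 2 ^+ s) = 
  (-1) ^+ n * haar R (x + m%:R / 2 ^+ s).
Proof.
have X0 : (2 : Q2) ^+ s != 0 by rewrite expf_neq0 ?Q2_2_neq0.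
rewrite natrD natrM natrX [_ + m%:R]addrC mulrDl mulrAC divff// mul1r addrA.
rewrite (haarD _ _ (Z2_nat n)) [RHS]mulrC; congr (_ * _).
elim: n => [|n IH]; first by rewrite haar0.
rewrite -natr1 haarD ?Z2_1// IH exprSr (@haar_odd _ 1)//.
by rewrite subrr mul0r Z2_0.
Qed.

(** Both sides change sign when [n] grows by [N], and for [n < N] both are 1 at 0 and 0
    elsewhere. *)
Lemma haar_dft (n : nat) :
  (haar R (n%:R / 2 ^+ s))%:C%C = N%:R^-1 * \sum_(r < N) uroot r ^+ n.
Proof.
have N0 : (N%:R : R[i]) != 0 by rewrite pnatr_eq0 -lt0n expn_gt0.
have nN : (n %% N < N)%N by rewrite ltn_mod expn_gt0.
rewrite {1}(divn_eq n N) mulnC -[X in haar R X]add0r haar_add_frac add0r.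
have := @haar_frac R _ _ 0 nN (ltac:(by rewrite expn_gt0)); rewrite mul0r subr0 => ->.
have urE (r : 'I_N) : uroot r ^+ n = (-1) ^+ (n %/ N) * uroot r ^+ (n %% N).
  by rewrite {1}(divn_eq n N) mulnC exprD exprM urootN.
under eq_bigr => r _ do rewrite urE.
rewrite -mulr_sumr uroot_col// mulrCA mulKf// rmorphM/=.
by rewrite rmorphXn rmorphN rmorph1 rmorph_nat.
Qed.

Lemma haar_dft2 (n k : nat) :
  (haar R (n%:R / 2 ^+ s - k%:R / 2 ^+ s))%:C%C =
  N%:R^-1 * \sum_(r < N) (uroot r ^+ n * (uroot r)^* ^+ k).
Proof.
(* Adding the even integer [2 * k] does not change [haar] and turns the difference of fractions into
   a fraction with natural numerator. *)
have k0 : (k <= N * (2 * k))%N.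
  by rewrite mulnA leq_pmull// muln_gt0 expn_gt0.
transitivity (haar R ((n + (N * (2 * k) - k))%N%:R / 2 ^+ s))%:C%C.
  have -> : (n + (N * (2 * k) - k))%N%:R / 2 ^+ s =
      n%:R / 2 ^+ s - k%:R / 2 ^+ s + (N * (2 * k) + 0)%:R / 2 ^+ s :> Q2.
    by rewrite addn0 natrD natrB// -mulrBl -mulrDl addrA addrAC.
  by rewrite haar_add_frac exprM expr2 mulrNN mulr1 expr1n mul1r mul0r addr0.
rewrite haar_dft; congr (_ * _); apply: eq_bigr => r _; rewrite exprD; congr (_ * _).
transitivity (uroot r ^+ (N * (2 * k) - k) * (uroot r * (uroot r)^* ) ^+ k).
  by rewrite urootV expr1n mulr1.
rewrite [(_ * _^* ) ^+ k]exprMn mulrA -exprD subnK//.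
by rewrite mulnA exprM exprM urootN sqrrN !expr1n mul1r.
Qed.

(** * The transform of the coefficients and the correlation of psi_s *)

Section Coeff.
Variable alpha : 'I_N -> R[i].

Definition dft (r : 'I_N) : R[i] := \sum_(k < N) alpha k * (uroot r)^* ^+ k.

(** The kernel obtained by exchanging the sums is [haar] at a difference of two fractions
    ([haar_dft2]), hence a Kronecker delta by [haar_frac]. *)
Lemma dft_inv k : alpha k = N%:R^-1 * \sum_(r < N) dft r * uroot r ^+ k.
Proof.
under eq_bigr => r _ do (rewrite /dft mulr_suml; under eq_bigr => l _ do
  rewrite -mulrA [_ * uroot r ^+ k]mulrC).
rewrite exchange_big mulr_sumr /= (bigD1 k)//= [X in _ + X]big1 ?addr0; last first.
  move=> l lk; rewrite -mulr_sumr mulrCA -haar_dft2 haar_frac// (inj_eq val_inj).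
  by rewrite eq_sym (negPf lk) mulr0.
by rewrite -mulr_sumr mulrCA -haar_dft2 subrr haar0 mulr1.
Qed.

Lemma dft_of (gamma : 'I_N -> R[i]) :
  (forall k : 'I_N, alpha k = N%:R^-1 * \sum_(r < N) gamma r * uroot r ^+ k) ->
  forall r, dft r = gamma r.
Proof.
have N0 : (N%:R : R[i]) != 0 by rewrite pnatr_eq0 -lt0n expn_gt0.
move=> a r; rewrite /dft; under eq_bigr => k _ do rewrite a -mulrA mulr_suml.
rewrite -mulr_sumr exchange_big/= mulr_sumr (bigD1 r)//= [X in _ + X]big1 ?addr0.
  under eq_bigr => k _ do rewrite -mulrA.
  rewrite -mulr_sumr uroot_row eqxx mulr1 mulrCA mulVf ?mulr1//.
move=> q qr; under eq_bigr => k _ do rewrite -mulrA.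
by rewrite -mulr_sumr uroot_row (negPf qr) !mulr0.
Qed.

(* The inner product of psi_s (y - a) and psi_s (y - b), as functions of y, is
   corr (a - b), see L2dot_dilate_shift. *)
Definition corr (x : Q2) : R[i] :=
  \sum_(k < N) \sum_(l < N) alpha k * (alpha l)^* *
    (haar R (x - k%:R / 2 ^+ s + l%:R / 2 ^+ s))%:C%C.

(** After expansion by [haar_dft2], the sums over [k] and [l] separate for each [r] into [dft r] and
    its conjugate. *)
Lemma corr_frac (m : nat) : corr (m%:R / 2 ^+ s) =
  N%:R^-1 * \sum_(r < N) uroot r ^+ m * `|dft r| ^+ 2.
Proof.
rewrite /corr; under eq_bigr => k _ do under eq_bigr => l _ do
  rewrite addrAC -mulrDl -natrD haar_dft2 mulrCA mulr_sumr.
under eq_bigr => k _ do rewrite -mulr_sumr exchange_big/=.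
rewrite -mulr_sumr exchange_big/=; congr (_ * _); apply: eq_bigr => r _.
rewrite normCK /dft rmorph_sum mulr_suml mulr_sumr; apply: eq_bigr => k _.
rewrite !mulr_sumr; apply: eq_bigr => l _ /=.
have -> : (alpha l * (uroot r)^* ^+ l)^* = (alpha l)^* * uroot r ^+ l.
  by rewrite [LHS]rmorphM [X in _ * X]rmorphXn/= conjCK.
by rewrite exprD; ring.
Qed.

(** If [2 ^+ s * x] is not integral, every term vanishes. Otherwise [x] is a fraction [m / 2 ^+ s]
    plus an integer; the integer contributes the same factor to both sides, and on fractions
    [corr_frac] becomes [haar_dft]. *)
Lemma corr_unit (x : Q2) : (forall r, `|dft r| = 1) -> corr x = (haar R x)%:C%C.
Proof.
move=> A1; have X0 : (2 : Q2) ^+ s != 0 by rewrite expf_neq0 ?Q2_2_neq0.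
have [Zx|nZx] := boolP (Z2 (2 ^+ s * x)); last first.
  have nZ (k l : nat) : haar R (x - k%:R / 2 ^+ s + l%:R / 2 ^+ s) = 0.
    apply: haar_out; apply: contra nZx => /(Z2M (Z2X s (Z2_nat 2))).
    rewrite mulrDr mulrBr ![2 ^+ s * (_ / _)]mulrC !mulfVK//.
    by rewrite Z2DB ?Z2_nat// Z2DB ?Z2N ?Z2_nat.
  rewrite -[x in RHS]subr0 -[x - 0]addr0 -(mul0r (2 ^+ s)^-1) (nZ 0%N 0%N).
  by rewrite /corr big1// => k _; rewrite big1// => l _; rewrite nZ mulr0.
have [b Zb] := Z2_digits Zx.
pose m := (\sum_(i < s) b i * 2 ^ i)%N; have Zm : Z2 (x - m%:R / 2 ^+ s).
  rewrite /m natr_sum; under eq_bigr => i _ do rewrite natrM natrX.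
  exact: Zb.
have haarm y : haar R (x + y) = haar R (x - m%:R / 2 ^+ s) * haar R (m%:R / 2 ^+ s + y).
  by rewrite [RHS]mulrC -haarD//; congr (haar _ _); ring.
transitivity ((haar R (x - m%:R / 2 ^+ s))%:C%C * corr (m%:R / 2 ^+ s)).
  rewrite /corr mulr_sumr; apply: eq_bigr => k _; rewrite mulr_sumr.
  apply: eq_bigr => l _; rewrite -addrA (haarm (_ + _)) [m%:R / _ + _]addrA.
  by rewrite [X in _ * X]rmorphM mulrCA.
rewrite -[x in RHS]addr0 (haarm 0) [RHS]rmorphM/= addr0 haar_dft corr_frac; congr (_ * (_ * _)).
by apply: eq_bigr => r _; rewrite A1 expr1n mulr1.
Qed.

(** Inverting [corr_frac] by row orthogonality expresses the squared modulus of [dft r] as the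
    transform of the values of [corr], here of a delta at 0, which is 1. *)
Lemma dft_unit : (forall m, (m < N)%N -> corr (m%:R / 2 ^+ s) = (m == 0)%N%:R) ->
  forall r, `|dft r| = 1.
Proof.
move=> G r; apply/eqP; rewrite -(@eqrXn2 _ 2)// expr1n; apply/eqP.
have N0 : (N%:R : R[i]) != 0 by rewrite pnatr_eq0 -lt0n expn_gt0.
transitivity (\sum_(m < N) (uroot r)^* ^+ m * corr (m%:R / 2 ^+ s)); last first.
  have N1 : (0 < N)%N by rewrite expn_gt0.
  rewrite (bigD1 (Ordinal N1))//= G// expr0 mulr1 big1 ?addr0// => m m0.
  by rewrite G// (negPf (m0 : (m : nat) != 0%N)) mulr0.
under eq_bigr => m _ do rewrite corr_frac mulrCA mulr_sumr.
rewrite -mulr_sumr exchange_big/= (bigD1 r)//= [X in _ + X]big1 ?addr0.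
  under eq_bigr => m _ do rewrite mulrA [_ ^+ m * _]mulrC.
  by rewrite -mulr_suml uroot_row eqxx mulr1 mulKf.
move=> q qr; under eq_bigr => m _ do rewrite mulrA [_ ^+ m * _]mulrC.
by rewrite -mulr_suml uroot_row (negPf qr) mulr0 mul0r.
Qed.

End Coeff.
End DFT.

(** * Square integrals of complex functions *)

Section SquareIntegral.
Context d (T : measurableType d) (R : realType).
Variable mu : {measure set T -> \bar R}.
Implicit Types f g : T -> R[i].

Definition sqrC (z : R[i]) : R := complex.Re z ^+ 2 + complex.Im z ^+ 2.

Lemma sqrC_ge0 z : 0 <= sqrC z.
Proof. by rewrite addr_ge0 ?sqr_ge0. Qed.

Lemma sqrCD z w : sqrC (z + w) <= 2 * sqrC z + 2 * sqrC w.
Proof.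
case: z w => [a b] [a' b']; rewrite /sqrC /=.
by have := sqr_ge0 (a - a'); have := sqr_ge0 (b - b'); nra.
Qed.

Lemma sqrCM z w : sqrC (z * w) = sqrC z * sqrC w.
Proof. by case: z w => [a b] [a' b']; rewrite /sqrC /=; ring. Qed.

Lemma sqrC_real (r : R) : sqrC r%:C%C = r ^+ 2.
Proof. by rewrite /sqrC /= expr0n/= addr0. Qed.

Definition cmeasurable f := measurable_fun setT (fun x => complex.Re (f x)) /\
  measurable_fun setT (fun x => complex.Im (f x)).

Lemma cmeasurableD f g : cmeasurable f -> cmeasurable g ->
  cmeasurable (fun x => f x + g x).
Proof.
move=> [fR fI] [gR gI]; split.
  by rewrite [X in measurable_fun _ X](_ : _ = (fun x => complex.Re (f x)) \+
    (fun x => complex.Re (g x))); [exact: measurable_funD|apply/funext => x; exact: raddfD].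
by rewrite [X in measurable_fun _ X](_ : _ = (fun x => complex.Im (f x)) \+
  (fun x => complex.Im (g x))); [exact: measurable_funD|apply/funext => x; exact: raddfD].
Qed.

Lemma cmeasurableM f g : cmeasurable f -> cmeasurable g ->
  cmeasurable (fun x => f x * g x).
Proof.
move=> [fR fI] [gR gI]; split.
  rewrite [X in measurable_fun _ X](_ : _ =
    ((fun x => complex.Re (f x)) \* (fun x => complex.Re (g x))) \+
    (\- ((fun x => complex.Im (f x)) \* (fun x => complex.Im (g x))))).
    by apply: measurable_funD; [|apply: measurable_funN]; exact: measurable_funM.
  by apply/funext => x /=; case: (f x) (g x) => [a b] [a' b'].
rewrite [X in measurable_fun _ X](_ : _ =
  ((fun x => complex.Re (f x)) \* (fun x => complex.Im (g x))) \+
  (((fun x => complex.Im (f x)) \* (fun x => complex.Re (g x))))).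
  by apply: measurable_funD; exact: measurable_funM.
by apply/funext => x /=; case: (f x) (g x) => [a b] [a' b'].
Qed.

Lemma cmeasurable_cst (c : R[i]) : cmeasurable (fun=> c).
Proof. by split; exact: measurable_cst. Qed.

Lemma cmeasurable_real (h : T -> R) :
  measurable_fun setT h -> cmeasurable (fun x => (h x)%:C%C).
Proof. by move=> mh; split => //; exact: measurable_cst. Qed.

Lemma cmeasurableB f g : cmeasurable f -> cmeasurable g ->
  cmeasurable (fun x => f x - g x).
Proof.
move=> mf mg; under eq_fun do rewrite -mulN1r.
by apply: cmeasurableD => //; apply: cmeasurableM => //; exact: cmeasurable_cst.
Qed.

Lemma measurable_sqrC f : cmeasurable f ->
  measurable_fun setT (fun x => (sqrC (f x))%:E).
Proof.
move=> [fR fI]; apply/measurable_EFinP.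
by apply: measurable_funD; exact: measurable_funX.
Qed.

(** The square of the L^2 norm. Estimates are made on it, with the pointwise bound [sqrCD] in place
    of the triangle inequality. *)
Definition sqrint f : \bar R := (\int[mu]_x (sqrC (f x))%:E)%E.

Lemma le_sqrint f g : cmeasurable f -> cmeasurable g ->
  (forall x, sqrC (f x) <= sqrC (g x)) -> (sqrint f <= sqrint g)%E.
Proof.
move=> mf mg fg; apply: ge0_le_integral => //.
- by move=> x _; rewrite lee_fin sqrC_ge0.
- exact: measurable_sqrC.
- exact: measurable_sqrC.
- by move=> x _; rewrite lee_fin.
Qed.

Lemma sqrint_ge0 f : (0 <= sqrint f)%E.
Proof. by apply: integral_ge0 => x _; rewrite lee_fin sqrC_ge0. Qed.

Lemma sqrintZ (c : R[i]) f : cmeasurable f ->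
  sqrint (fun x => c * f x) = ((sqrC c)%:E * sqrint f)%E.
Proof.
move=> mf; rewrite /sqrint -ge0_integralZl ?lee_fin ?sqrC_ge0//.
- by apply: eq_integral => x _; rewrite sqrCM EFinM.
- exact: measurable_sqrC.
- by move=> x _; rewrite lee_fin sqrC_ge0.
Qed.

Lemma sqrintD f g : cmeasurable f -> cmeasurable g ->
  (sqrint (fun x => f x + g x)%R <= 2%:E * sqrint f + 2%:E * sqrint g)%E.
Proof.
move=> mf mg; have ge0 h x : (0 <= (sqrC (h x : R[i]))%:E)%E by rewrite lee_fin sqrC_ge0.
rewrite /sqrint -!ge0_integralZl//; [|exact: measurable_sqrC..].
rewrite -ge0_integralD//.
- apply: ge0_le_integral => //.
  + exact/measurable_sqrC/cmeasurableD.
  + apply: emeasurable_funD; apply: measurable_funeM; exact: measurable_sqrC.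
  + by move=> x _; rewrite -!EFinM -EFinD lee_fin sqrCD.
- by move=> x _; rewrite mule_ge0.
- by apply: measurable_funeM; exact: measurable_sqrC.
- by move=> x _; rewrite mule_ge0.
- by apply: measurable_funeM; exact: measurable_sqrC.
Qed.

Lemma sqrint_indic (A : set T) : measurable A ->
  sqrint (fun x => (\1_A x)%:C%C) = mu A.
Proof.
move=> mA; rewrite -[in RHS](setIT A) -integral_indic//; apply: eq_integral => x _.
by rewrite sqrC_real indicE; case: (_ \in _); rewrite ?expr1n// expr0n.
Qed.

Lemma L2normE f : L2norm mu f = sqrte (sqrint f).
Proof.
rewrite /L2norm unlock -poweR12_sqrt ?sqrint_ge0//; congr (_ `^ _)%E.
apply: eq_integral => x _; rewrite abse_EFin poweR_EFin powR_mulrn//; congr EFin.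
case: (f x) => a b; rewrite /sqrC /= ger0_norm ?sqrtr_ge0// sqr_sqrtr//.
by rewrite addr_ge0 ?sqr_ge0.
Qed.

Lemma L2P f : L2 mu f <-> cmeasurable f /\ (sqrint f < +oo)%E.
Proof.
rewrite /L2 L2normE; have := sqrint_ge0 f.
case: (sqrint f) => [r| |]//= r0; split => [[mR mI fin]|[[mR mI] fin]].
- by split; [split|rewrite ltry].
- by split => //; rewrite ltry.
- by split.
- by split.
Qed.

Lemma L2norm_lt f (eps : R) : 0 < eps -> (sqrint f < (eps ^+ 2)%:E)%E ->
  (L2norm mu f < eps%:E)%E.
Proof.
move=> e0; rewrite L2normE; have := sqrint_ge0 f.
case: (sqrint f) => [r| |]//=; rewrite lee_fin !lte_fin => r0 re.
by rewrite -(ger0_norm (ltW e0)) -sqrtr_sqr ltr_sqrt// exprn_gt0.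
Qed.

Lemma L2D f g : L2 mu f -> L2 mu g -> L2 mu (fun x => f x + g x).
Proof.
move=> /L2P[mf f_fin] /L2P[mg g_fin]; apply/L2P; split; first exact: cmeasurableD.
rewrite (le_lt_trans (sqrintD mf mg))// lte_add_pinfty// lte_mul_pinfty//.
Qed.

Lemma L2Z c f : L2 mu f -> L2 mu (fun x => c * f x).
Proof.
move=> /L2P[mf f_fin]; apply/L2P; split.
  by apply: cmeasurableM => //; exact: cmeasurable_cst.
by rewrite sqrintZ// lte_mul_pinfty// lee_fin sqrC_ge0.
Qed.

Lemma L2_0 : L2 mu (fun=> 0).
Proof.
apply/L2P; split; first exact: cmeasurable_cst.
rewrite /sqrint (eq_integral (cst 0%E)) ?integral0// => x _.
by rewrite /sqrC /= expr0n/= addr0.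
Qed.

Lemma L2_sum (I : Type) (s : seq I) (h : I -> T -> R[i]) :
  (forall i, L2 mu (h i)) -> L2 mu (fun x => \sum_(i <- s) h i x).
Proof.
move=> mh; elim: s => [|i s IH]; first by under eq_fun do rewrite big_nil; exact: L2_0.
by under eq_fun do rewrite big_cons; exact: L2D.
Qed.

Lemma L2_indic (A : set T) : measurable A -> (mu A < +oo)%E ->
  L2 mu (fun x => (\1_A x)%:C%C).
Proof.
move=> mA A_fin; apply/L2P; split; last by rewrite sqrint_indic.
exact/cmeasurable_real/measurable_indic.
Qed.

End SquareIntegral.

(** * The closed span of a family in L^2 *)

Section Adherence.
Context d (T : measurableType d) (R : realType).
Variable mu : {measure set T -> \bar R}.
Variables (I : eqType) (D : set I) (e : I -> T -> R[i]).
Hypothesis e_L2 : forall i, D i -> L2 mu (e i).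
Implicit Types (f g : T -> R[i]) (l : seq (I * R[i])).

(** Indices may repeat in the list, so that a sum of combinations is a concatenation;
    [adherent_total] merges the repetitions. *)
Definition comb l (x : T) : R[i] := \sum_(p <- l) p.2 * e p.1 x.

Definition adherent f := cmeasurable f /\
  forall eps : R, 0 < eps -> exists l, (forall p, p \in l -> D p.1) /\
    (sqrint mu (fun x => f x - comb l x)%R < eps%:E)%E.

Lemma L2_comb l : (forall p, p \in l -> D p.1) -> L2 mu (comb l).
Proof.
rewrite /comb; elim: l => [|p l IH] lD.
  by under eq_fun do rewrite big_nil; exact: L2_0.
under eq_fun do rewrite big_cons; apply: L2D; last first.
  by apply: IH => q ql; apply: lD; rewrite inE ql orbT.
by apply/L2Z/e_L2/lD; rewrite inE eqxx.
Qed.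

Lemma cmeasurable_comb l : (forall p, p \in l -> D p.1) -> cmeasurable (comb l).
Proof. by move=> /L2_comb/L2P[]. Qed.

Lemma lte_add_double_quarter (x y : \bar R) (eps : R) :
  (x < (eps / 4)%:E)%E -> (y < (eps / 4)%:E)%E ->
  (2%:E * x + 2%:E * y < eps%:E)%E.
Proof.
move=> xe ye; have -> : eps = 2 * (eps / 4) + 2 * (eps / 4) by lra.
by rewrite (EFinD (2 * (eps / 4))) (EFinM 2) lteD// lte_pmul2l.
Qed.

Lemma adherentD f g : adherent f -> adherent g -> adherent (fun x => f x + g x).
Proof.
move=> [mf fa] [mg ga]; split=> [|eps e0]; first exact: cmeasurableD.
have e4 : 0 < eps / 4 by rewrite divr_gt0.
have [l [lD fl]] := fa _ e4; have [l' [lD' gl]] := ga _ e4.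
exists (l ++ l'); split; first by move=> p; rewrite mem_cat => /orP[/lD|/lD'].
have -> : (fun x => f x + g x - comb (l ++ l') x) =
    (fun x => (f x - comb l x) + (g x - comb l' x)).
  by apply/funext => x; rewrite /comb big_cat/= opprD addrACA.
rewrite (le_lt_trans (sqrintD _ _ _)) ?lte_add_double_quarter//;
  by apply: cmeasurableB => //; exact: cmeasurable_comb.
Qed.

Lemma adherentZ c f : adherent f -> adherent (fun x => c * f x).
Proof.
move=> [mf fa]; split=> [|eps e0].
  by apply: cmeasurableM => //; exact: cmeasurable_cst.
(* The summand 1 keeps the divisor positive when [c] is 0. *)
have c0 : 0 < sqrC c + 1 by rewrite ltr_wpDl ?sqrC_ge0.
have [l [lD fl]] := fa _ (divr_gt0 e0 c0).
exists [seq (p.1, c * p.2) | p <- l]; split; first by move=> p /mapP[q /lD ? ->].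
have -> : (fun x => c * f x - comb [seq (p.1, c * p.2) | p <- l] x) =
    (fun x => c * (f x - comb l x)).
  apply/funext => x; rewrite /comb big_map/= mulrBr mulr_sumr; congr (_ - _).
  by apply: eq_bigr => p _; rewrite mulrA.
rewrite sqrintZ; last by apply: cmeasurableB => //; exact: cmeasurable_comb.
apply: (@le_lt_trans _ _ ((sqrC c + 1)%:E * sqrint mu (fun x => f x - comb l x)%R)%E).
  by rewrite lee_wpmul2r ?sqrint_ge0// lee_fin lerDl.
by rewrite muleC -lte_pdivlMr// -EFinM.
Qed.

Lemma adherent_lim f : cmeasurable f ->
  (forall eps : R, 0 < eps -> exists2 g, adherent g &
    (sqrint mu (fun x => f x - g x)%R < eps%:E)%E) -> adherent f.
Proof.
move=> mf fa; split=> // eps e0; have e4 : 0 < eps / 4 by rewrite divr_gt0.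
have [g [mg ga] fg] := fa _ e4; have [l [lD gl]] := ga _ e4.
exists l; split => //.
have -> : (fun x => f x - comb l x) = (fun x => (f x - g x) + (g x - comb l x)).
  by apply/funext => x; rewrite addrA subrK.
rewrite (le_lt_trans (sqrintD _ _ _)) ?lte_add_double_quarter//; first exact: cmeasurableB.
by apply: cmeasurableB => //; exact: cmeasurable_comb.
Qed.

Lemma sqrint0 : sqrint mu (fun=> 0) = 0%E.
Proof.
rewrite /sqrint (eq_integral (cst 0%E)) ?integral0// => x _.
by rewrite /sqrC /= expr0n/= addr0.
Qed.

Lemma adherent_comb l : (forall p, p \in l -> D p.1) -> adherent (comb l).
Proof.
move=> lD; split=> [|eps e0]; first exact: cmeasurable_comb.
exists l; split => //; under [X in sqrint _ X]eq_fun do rewrite subrr.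
by rewrite sqrint0 lte_fin.
Qed.

Lemma adherent_gen i : D i -> adherent (e i).
Proof.
move=> Di; have -> : e i = comb [:: (i, 1)].
  by apply/funext => x; rewrite /comb big_seq1 mul1r.
by apply: adherent_comb => p; rewrite inE => /eqP ->.
Qed.

Lemma adherent0 : adherent (fun=> 0).
Proof.
have -> : (fun=> 0) = comb [::] by apply/funext => x; rewrite /comb big_nil.
exact: adherent_comb.
Qed.

Lemma adherent_sum (J : Type) (s : seq J) (h : J -> T -> R[i]) :
  (forall i, adherent (h i)) -> adherent (fun x => \sum_(i <- s) h i x).
Proof.
move=> mh; elim: s => [|i s IH]; first by under eq_fun do rewrite big_nil; exact: adherent0.
by under eq_fun do rewrite big_cons; exact: adherentD.
Qed.

Lemma adherent_total : (forall f, L2 mu f -> adherent f) -> total_system mu D e.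
Proof.
move=> fa f /fa[mf {}fa] eps e0; have [l [lD fl]] := fa _ (exprn_gt0 2 e0).
(* Each index is kept once, with the sum of all its coefficients in [l]. *)
exists (undup [seq p.1 | p <- l]), (fun i => \sum_(p <- l | p.1 == i) p.2); split.
  by move=> i; rewrite mem_undup => /mapP[p /lD ? ->].
apply: L2norm_lt => //; apply: le_lt_trans fl; rewrite le_eqVlt; apply/orP; left.
apply/eqP; congr (sqrint mu _); apply/funext => x; congr (_ - _).
rewrite /comb; under eq_bigr => i _ do rewrite mulr_suml big_mkcond.
rewrite exchange_big/= !big_seq; apply: eq_bigr => p pl.
rewrite (bigD1_seq p.1) ?undup_uniq ?mem_undup ?map_f//= eqxx [X in _ + X]big1 ?addr0//.
by move=> i; rewrite eq_sym => /negPf ->.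
Qed.

(** The squared errors are dominated by the integrable square of [f], so pointwise convergence gives
    convergence in L^2. *)
Lemma adherent_dominated f (g : nat -> T -> R[i]) : L2 mu f ->
  (forall n, adherent (g n)) ->
  (forall x, sqrC (f x - g n x) @[n --> \oo] --> (0 : R)) ->
  (forall n x, sqrC (f x - g n x) <= sqrC (f x)) -> adherent f.
Proof.
move=> /L2P[mf f_fin] ga fg dom; apply: adherent_lim => // eps e0.
have mfg n : cmeasurable (fun x => f x - g n x).
  by apply: cmeasurableB => //; have [] := ga n.
have := @dominated_convergence _ _ _ mu _ measurableT
  (fun n x => (sqrC (f x - g n x))%:E) (cst 0%E) (fun x => (sqrC (f x))%:E).
case.
- by move=> n; exact: measurable_sqrC.
- exact: measurable_cst.
- by apply: aeW => x _; apply: cvg_EFin; [exact: nearW|exact: fg].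
- apply/integrableP; split; first exact: measurable_sqrC.
  by under eq_integral do rewrite gee0_abs ?lee_fin ?sqrC_ge0//.
- by apply: aeW => x n _; rewrite gee0_abs ?lee_fin ?sqrC_ge0.
move=> _ _; rewrite integral0.
move=> /fine_cvgP[[N1 _ fin] /cvgrPdist_lt/(_ _ e0)[N2 _ lt]].
pose n := maxn N1 N2; exists (g n) => //.
have := lt n (leq_maxr _ _); rewrite /= sub0r normrN => /(le_lt_trans (ler_norm _)).
rewrite -lte_fin fineK//; exact: fin (leq_maxl _ _).
Qed.

(** * From indicators of sets of finite measure to all of L^2 *)

Hypothesis indic_adherent : forall A : set T, measurable A -> (mu A < +oo)%E ->
  adherent (fun x => (\1_A x)%:C%C).

(** A Chebyshev bound: for positive [c] the square-integrable majorant [h] forces [A] to have finite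
    measure. The case [c = 0] is separate, since [A] may then have infinite measure. *)
Lemma adherent_Zindic (c : R) (A : set T) (h : T -> R) : measurable A -> 0 <= c ->
  L2 mu (fun x => (h x)%:C%C) -> (forall x, c * \1_A x <= h x) ->
  adherent (fun x => (c * \1_A x)%:C%C).
Proof.
move=> mA; rewrite le_eqVlt => /predU1P[<- _ _|c0 /L2P[mh h_fin] ch].
  by under eq_fun do rewrite mul0r; exact: adherent0.
have mIA : cmeasurable (fun x => (\1_A x)%:C%C : R[i]).
  exact/cmeasurable_real/measurable_indic.
have -> : (fun x => (c * \1_A x)%:C%C) = (fun x => c%:C%C * (\1_A x)%:C%C).
  by apply/funext => x; rewrite rmorphM.
apply/adherentZ/indic_adherent => //.
have : (sqrint mu (fun x => c%:C%C * (\1_A x)%:C%C)%R < +oo)%E.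
  apply: le_lt_trans h_fin; apply: le_sqrint => //.
    by apply: cmeasurableM => //; exact: cmeasurable_cst.
  move=> x; rewrite -rmorphM !sqrC_real.
  have cA0 : 0 <= c * \1_A x by rewrite mulr_ge0 ?indicE// ltW.
  by rewrite lerXn2r ?nnegrE// (le_trans cA0).
rewrite sqrintZ// sqrint_indic// sqrC_real.
by case: (mu A) => [r| |]//; rewrite ?ltry// gt0_muley// lte_fin exprn_gt0.
Qed.

(** The dyadic simple approximations lie between 0 and [h] and converge to it; each of their terms
    is itself below [h], so [adherent_Zindic] applies to it. *)
Lemma adherent_nneg (h : T -> R) : (forall x, 0 <= h x) ->
  L2 mu (fun x => (h x)%:C%C) -> adherent (fun x => (h x)%:C%C).
Proof.
move=> h0 hL2; have [[mh _] _] := (L2P _ _).1 hL2.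
have mEh : measurable_fun setT (EFin \o h) by exact/measurable_EFinP.
have h0E x : setT x -> (0 <= (EFin \o h) x)%E by rewrite /= lee_fin.
pose g := measurable_fun_approximation.approx setT (EFin \o h).
pose A n k := dyadic_approx setT (EFin \o h) n k.
pose B n := integer_approx setT (EFin \o h) n.
have mA n k : measurable (A n k).
  rewrite /A /dyadic_approx; case: ifPn => // _; rewrite -preimage_comp.
  by apply: mEh => //; apply/measurable_image_EFin; exact: measurable_itv.
have mB n : measurable (B n) by exact: emeasurable_fun_c_infty.
have A0 n k x : 0 <= k%:R / 2 ^+ n * \1_(A n k) x by rewrite mulr_ge0 ?indicE.
have B0 n x : 0 <= n%:R * \1_(B n) x :> R by rewrite mulr_ge0 ?indicE.
have g_le n x : g n x <= h x.
  by rewrite -lee_fin; exact: (le_approx n h0E).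
have g_ge0 n x : 0 <= g n x by rewrite addr_ge0 ?sumr_ge0// => i _; exact: A0.
apply: (@adherent_dominated _ (fun n x => (g n x)%:C%C)) => //.
- move=> n; have -> : (fun x => (g n x)%:C%C) = (fun x =>
      \sum_(k < n * 2 ^ n) (k%:R / 2 ^+ n * \1_(A n k) x)%:C%C + (n%:R * \1_(B n) x)%:C%C).
    by apply/funext => x; rewrite /g/measurable_fun_approximation.approx rmorphD rmorph_sum.
  apply: adherentD; last first.
    apply: adherent_Zindic hL2 _ => // x; apply: le_trans (g_le n x).
    by rewrite lerDr sumr_ge0// => i _; exact: A0.
  apply: adherent_sum => k; apply: adherent_Zindic hL2 _ => // x.
  apply: le_trans (g_le n x); rewrite /g /measurable_fun_approximation.approx (bigD1 k)//=.
  by rewrite -addrA lerDl addr_ge0 ?sumr_ge0// => i _; exact: A0.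
- move=> x; under eq_fun do rewrite -rmorphB sqrC_real.
  have gh : g n x @[n --> \oo] --> h x by exact: (cvg_approx h0E Logic.I (ltry (h x))).
  have d0 : h x - g n x @[n --> \oo] --> 0.
    by rewrite -(subrr (h x)); apply: cvgB => //; exact: cvg_cst.
  by under eq_fun do rewrite expr2; rewrite -(mulr0 0); exact: cvgM.
- move=> n x; rewrite -rmorphB !sqrC_real lerXn2r ?nnegrE ?subr_ge0 ?g_le//.
  by rewrite gerDl oppr_le0.
Qed.

Lemma adherent_real (h : T -> R) :
  L2 mu (fun x => (h x)%:C%C) -> adherent (fun x => (h x)%:C%C).
Proof.
move=> /L2P[[mh _] h_fin].
have part (h' : T -> R) : measurable_fun setT h' -> (forall x, 0 <= h' x <= `|h x|) ->
    adherent (fun x => (h' x)%:C%C).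
  move=> mh' h'h; apply: adherent_nneg => [x|]; first by have /andP[] := h'h x.
  apply/L2P; split; first exact: cmeasurable_real.
  apply: le_lt_trans h_fin; apply: le_sqrint; try exact: cmeasurable_real.
  move=> x; rewrite !sqrC_real -[leRHS]real_normK ?num_real//.
  by have /andP[h'0 ?] := h'h x; rewrite lerXn2r ?nnegrE.
have -> : (fun x => (h x)%:C%C) = (fun x => (h^\+ x)%:C%C + (-1) * (h^\- x)%:C%C).
  by apply/funext => x; rewrite mulN1r -rmorphB -{1}(funrposBneg h).
apply: adherentD; last apply: adherentZ; apply: part.
- exact: measurable_funrpos.
- move=> x; rewrite funrpos_ge0/= /funrpos ge_max ler_norm normr_ge0//.
- exact: measurable_funrneg.
- by move=> x; rewrite funrneg_ge0/= /funrneg ge_max -{1}normrN ler_norm normr_ge0.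
Qed.

Lemma adherent_L2 f : L2 mu f -> adherent f.
Proof.
move=> /L2P[[fR fI] f_fin].
have part (h : T -> R) : measurable_fun setT h -> (forall x, h x ^+ 2 <= sqrC (f x)) ->
    adherent (fun x => (h x)%:C%C).
  move=> mh hf; apply: adherent_real; apply/L2P; split; first exact: cmeasurable_real.
  apply: le_lt_trans f_fin; apply: le_sqrint; [exact: cmeasurable_real|by split|].
  by move=> x; rewrite sqrC_real.
have -> : f = (fun x => (complex.Re (f x))%:C%C + 'i%C * (complex.Im (f x))%:C%C).
  by apply/funext => x; rewrite -complexE.
apply: adherentD; last apply: adherentZ; apply: part => // x.
- by rewrite lerDl sqr_ge0.
- by rewrite lerDr sqr_ge0.
Qed.

End Adherence.

(** * Balls of Q_2 *)

Lemma integrable_scale d (T : measurableType d) (R : realType)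
    (mu : {measure set T -> \bar R}) (c : R) (f : T -> R) :
  mu.-integrable setT (EFin \o f) -> mu.-integrable setT (EFin \o (fun x => c * f x)).
Proof.
move=> fi; have -> : EFin \o (fun x => c * f x) = (fun x => c%:E * (f x)%:E)%E.
  by apply/funext => x /=; rewrite EFinM.
exact: (integrableZl measurableT c fi).
Qed.

Lemma affine_change (F : fieldType) (u v x b c : F) : u != 0 ->
  v * x - c = v * (u^-1 * b) - c + v / u * (u * x - b).
Proof. by move=> u0; field. Qed.

(** The ball of radius [2 ^ k] about [(2 ^ k)^-1 * b], parametrized by the affine argument that
    occurs in [dilate_shift]. *)
Definition ball2 (k : int) (b : Q2) : set Q2 := [set x | Z2 (2 ^ k * x - b)].

Lemma Q2X_neq0 (k : int) : (2 : Q2) ^ k != 0.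
Proof. by rewrite expfz_neq0// Q2_2_neq0. Qed.

Lemma Q2XS (k : int) : (2 : Q2) ^ k = 2 * 2 ^ (k - 1).
Proof. by rewrite -{2}[2](expr1z) -expfzDr ?Q2_2_neq0// addrC subrK. Qed.

Lemma open2_ball2 k b : open2 (ball2 k b).
Proof.
move=> x; rewrite /ball2/= => xB; pose r := norm2 (2 ^ k) + 1.
have r0 : 0 < r by rewrite ltr_wpDl ?norm2_ge0.
exists r^-1; first by rewrite invr_gt0.
move=> y /= xy; have -> : 2 ^ k * y - b = 2 ^ k * (y - x) + (2 ^ k * x - b).
  by rewrite mulrBr addrA subrK.
rewrite Z2D// Z2E (le_trans (norm2M_le _ _))//.
rewrite (le_trans (ler_wpM2l (norm2_ge0 _) (ltW xy)))// ler_pdivrMr// mul1r.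
by rewrite lerDl.
Qed.

Lemma measurable_ball2 k b : measurable (ball2 k b : set borelQ2).
Proof. by apply: sub_sigma_algebra; exact: open2_ball2. Qed.

(** Ultrametric balls that meet are nested: [2 ^ k' * (y - x)] is an integral multiple of
    [2 ^ k * (y - x)], which is integral. *)
Lemma ball2_sub k b k' b' x : k <= k' -> ball2 k b x -> ball2 k' b' x ->
  ball2 k b `<=` ball2 k' b'.
Proof.
move=> kk' xB xB' y yB; rewrite /ball2/= in xB xB' yB *.
have -> : 2 ^ k' * y - b' = 2 ^ k' * (y - x) + (2 ^ k' * x - b').
  by rewrite mulrBr addrA subrK.
rewrite Z2D//; have [n ->] : exists n : nat, k' = n%:Z + k.
  by exists `|k' - k|%N; rewrite gez0_abs ?subr_ge0// subrK.
rewrite expfzDr ?Q2_2_neq0// -mulrA Z2M ?Z2X ?(Z2_nat 2)//.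
by have := Z2B yB xB; rewrite opprB addrA subrK mulrBr.
Qed.

Lemma Q2_scale_half k (x c : Q2) : 2 ^ (k - 1) * x - c / 2 = (2 ^ k * x - c) / 2.
Proof. by rewrite mulrBl [in RHS](Q2XS k) -mulrA [2 * _]mulrC mulfK ?Q2_2_neq0. Qed.

Lemma ball2_split k b :
  ball2 k b = ball2 (k - 1) (b / 2) `|` ball2 (k - 1) ((b + 1) / 2).
Proof.
apply/seteqP; split => x; rewrite /ball2/= !Q2_scale_half opprD addrA.
  by move/Z2_residue/orP.
by move=> [/Z2_double|/Z2_double1].
Qed.

Section BallMeasure.
Variables (R : realType) (mu : {measure set borelQ2 -> \bar R}).
Hypothesis hmu : is_haar mu.

Lemma measure_ball2_center k b : mu (ball2 k b) = mu (ball2 k 0).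
Proof.
rewrite -(hmu.1 ((2 ^ k)^-1 * b) _ (measurable_ball2 k 0)); congr (mu _).
apply/seteqP; split => [x xB|_ [x xB <-]]; rewrite /ball2/=.
  exists (x - (2 ^ k)^-1 * b); last by rewrite addrC subrK.
  by rewrite /ball2/= subr0 mulrBr mulVKf ?Q2X_neq0.
by rewrite mulrDr mulVKf ?Q2X_neq0// addrC addKr; rewrite /ball2/= subr0 in xB.
Qed.

Lemma measure_ball2_half k :
  mu (ball2 k 0) = (mu (ball2 (k - 1) 0)%R + mu (ball2 (k - 1) 0)%R)%E.
Proof.
rewrite ball2_split measureU; [|exact: measurable_ball2..|].
  by congr (_ + _)%E; exact: measure_ball2_center.
apply/seteqP; split => // x [] /[swap]; rewrite /ball2/= mul0r subr0 add0r => xB xB'.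
by have := Z2B xB' xB; rewrite opprB addrC subrK; apply/negP; exact: nZ2_half.
Qed.

(** A ball splits into two balls of half the radius, of equal measure by invariance; doubling and
    halving from the measure 1 of Z_2 reaches every scale. *)
Lemma measure_ball2 k b : mu (ball2 k b) = (2 ^ k)%:E.
Proof.
rewrite measure_ball2_center; elim/int_rec: k => [|n IH|n IH].
- rewrite expr0z -[RHS]hmu.2; congr (mu _); apply/funext => x.
  by rewrite /ball2/= expr0z mul1r subr0 Z2E.
- rewrite measure_ball2_half -addn1 PoszD addrK IH -EFinD; congr EFin.
  by rewrite -PoszD addn1 exprSz mulr_natl mulr2n.
- have := measure_ball2_half (- n%:Z); rewrite IH.
  have -> : - n%:Z - 1 = - n.+1%:Z by rewrite -addn1 PoszD opprD.
  (* The doubled measure is finite, which excludes the infinite values. *)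
  case: (mu _) => [r| |]//; rewrite -EFinD => -[nr]; congr EFin.
  have -> : - n.+1%:Z = - n%:Z - 1 by rewrite -addn1 PoszD opprD.
  by rewrite expfzDr ?pnatr_eq0// nr exprN1; lra.
Qed.

Lemma measure_ball2_lty k b : (mu (ball2 k b) < +oo)%E.
Proof. by rewrite measure_ball2 ltry. Qed.

Definition haarf k b (x : Q2) : R := haar R (2 ^ k * x - b).

Lemma indic_ball2 k b x : \1_(ball2 k b) x = (Z2 (2 ^ k * x - b))%:R :> R.
Proof. by rewrite indicE; congr (nat_of_bool _)%:R; apply/idP/idP; rewrite inE. Qed.

Lemma haarfE k b x : haarf k b x =
  \1_(ball2 (k - 1) (b / 2)) x - \1_(ball2 (k - 1) ((b + 1) / 2)) x.
Proof.
by rewrite !indic_ball2 !Q2_scale_half opprD addrA.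
Qed.

Lemma integrable_ball2 k b :
  mu.-integrable setT (EFin \o (\1_(ball2 k b) : borelQ2 -> R)).
Proof.
have mB := measurable_ball2 k b; apply/integrableP; split.
  exact/measurable_EFinP/measurable_indic.
rewrite (eq_integral (fun x : borelQ2 => (\1_(ball2 k b) x)%:E)); last first.
  by move=> x _; rewrite gee0_abs// lee_fin indicE.
by rewrite integral_indic// setIT measure_ball2_lty.
Qed.

Lemma Rintegral_ball2 k b : \int[mu]_x (\1_(ball2 k b) x : R) = 2 ^ k.
Proof.
have mB := measurable_ball2 k b.
by rewrite /Rintegral integral_indic// setIT measure_ball2.
Qed.

Lemma integrable_haarf k b : mu.-integrable setT (EFin \o (haarf k b : borelQ2 -> R)).
Proof.
pose B b' := EFin \o (\1_(ball2 (k - 1) (b' / 2)) : borelQ2 -> R).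
rewrite (_ : _ \o _ = B b \- B (b + 1)%R)%E; last first.
  by apply/funext => x /=; rewrite haarfE EFinB.
by apply: integrableB => //; exact: integrable_ball2.
Qed.

Lemma Rintegral_haarf k b : \int[mu]_x haarf k b x = 0.
Proof.
under eq_Rintegral do rewrite haarfE.
by rewrite RintegralB//; [|exact: integrable_ball2..]; rewrite !Rintegral_ball2 subrr.
Qed.

(** On the support of the finer function, the argument of the coarser one differs from its value at
    the centre by an element of 2 Z_2, on which [haar] is 1. *)
Lemma haarf_cst k b k' b' x : k < k' ->
  haarf k b x * haarf k' b' x = haarf k' b' ((2 ^ k)^-1 * b) * haarf k b x.
Proof.
move=> kk'; have [Zx|nZx] := boolP (Z2 (2 ^ k * x - b)); last first.
  by rewrite /haarf [haar R (2 ^ k * x - b)]haar_out// mul0r mulr0.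
rewrite mulrC; congr (_ * _); rewrite /haarf.
have -> : 2 ^ k' * x - b' = (2 ^ k' * ((2 ^ k)^-1 * b) - b') +
    2 ^ (k' - k) * (2 ^ k * x - b).
  by rewrite expfzDr ?Q2_2_neq0// -invr_expz; apply: affine_change; exact: Q2X_neq0.
have [n ->] : exists n : nat, k' - k = n%:Z + 1.
  exists (absz (k' - k - 1)%R); rewrite gez0_abs ?subrK//.
  by rewrite subr_ge0 -gtz0_ge1 subr_gt0.
have Zn : Z2 (2 ^ n * (2 ^ k * x - b)) by rewrite Z2M ?Z2X ?(Z2_nat 2).
rewrite expfzDr ?Q2_2_neq0// expr1z mulrAC haarD.
  by rewrite [X in _ * X]haar_even ?mulr1// mulfK ?Q2_2_neq0.
by rewrite Z2M ?(Z2_nat 2).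
Qed.

(** At equal scales the product is a multiple of a ball indicator. At different scales the coarser
    factor is constant on the support of the finer one, whose integral is 0. *)
Lemma haarf_dot k b k' b' :
  mu.-integrable setT (EFin \o (fun x : borelQ2 => haarf k b x * haarf k' b' x)) /\
  \int[mu]_x (haarf k b x * haarf k' b' x) = (k == k')%:R * (2 ^ k * haar R (b - b')).
Proof.
wlog kk' : k b k' b' / k <= k'.
  move=> hw; have [|/ltW] := leP k k' => le; first exact: hw.
  have [i1 i2] := hw k' b' k b le; split.
    by under [X in EFin \o X]eq_fun do rewrite mulrC.
  under eq_Rintegral do rewrite mulrC; rewrite i2 -haarN opprB eq_sym.
  by have [->|] := eqVneq k k'; rewrite ?mul0r.
move: kk'; rewrite le_eqVlt => /predU1P[->|kk'].
  rewrite eqxx mul1r; under [X in EFin \o X]eq_fun do rewrite /haarf haarM -indic_ball2.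
  under eq_Rintegral do rewrite /haarf haarM -indic_ball2; split.
    by apply: integrable_scale; exact: integrable_ball2.
  by rewrite RintegralZl//; [rewrite Rintegral_ball2 mulrC|exact: integrable_ball2].
rewrite (lt_eqF kk') mul0r; under [X in EFin \o X]eq_fun do rewrite haarf_cst//.
under eq_Rintegral do rewrite haarf_cst//; split.
  by apply: integrable_scale; exact: integrable_haarf.
by rewrite RintegralZl//; [rewrite Rintegral_haarf mulr0|exact: integrable_haarf].
Qed.

End BallMeasure.

(** * Gram matrix *)

Section ComplexIntegral.
Context d (T : measurableType d) (R : realType).
Variable mu : {measure set T -> \bar R}.

Lemma Rintegral_lincomb (J : Type) (s : seq J) (c : J -> R) (h : J -> T -> R) :
  (forall j, mu.-integrable setT (EFin \o h j)) ->
  mu.-integrable setT (EFin \o (fun x => \sum_(j <- s) c j * h j x)) /\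
  \int[mu]_x (\sum_(j <- s) c j * h j x) = \sum_(j <- s) c j * \int[mu]_x h j x.
Proof.
move=> hi; have chi j : mu.-integrable setT (EFin \o (fun x => c j * h j x)).
  exact: integrable_scale.
elim: s => [|j s [IH1 IH2]].
  split; last first.
    under eq_Rintegral do rewrite big_nil.
    by rewrite big_nil /Rintegral integral0.
  rewrite (_ : _ \o _ = cst 0%E); first exact: integrable0.
  by apply/funext => x /=; rewrite big_nil.
split; last first.
  under eq_Rintegral do rewrite big_cons.
  by rewrite big_cons RintegralD// RintegralZl// IH2.
rewrite (_ : _ \o _ = (EFin \o (fun x => c j * h j x)%R) \+
    (EFin \o (fun x => \sum_(j <- s) c j * h j x)%R))%E; last first.
  by apply/funext => x /=; rewrite big_cons EFinD.
exact: integrableD.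
Qed.

Lemma Re_lincomb (J : Type) (s : seq J) (z : J -> R[i]) (r : J -> R) :
  complex.Re (\sum_(j <- s) z j * (r j)%:C%C) = \sum_(j <- s) complex.Re (z j) * r j.
Proof.
rewrite (big_morph (@complex.Re R) (id1 := 0) (op1 := +%R))//; last by case=> ? ? [].
by apply: eq_bigr => j _; case: (z j) => a b /=; rewrite mulr0 subr0.
Qed.

Lemma Im_lincomb (J : Type) (s : seq J) (z : J -> R[i]) (r : J -> R) :
  complex.Im (\sum_(j <- s) z j * (r j)%:C%C) = \sum_(j <- s) complex.Im (z j) * r j.
Proof.
rewrite (big_morph (@complex.Im R) (id1 := 0) (op1 := +%R))//; last by case=> ? ? [].
by apply: eq_bigr => j _; case: (z j) => a b /=; rewrite mulr0 add0r.
Qed.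

Lemma L2dot_lincomb (J : Type) (s : seq J) (z : J -> R[i]) (h : J -> T -> R)
    (f g : T -> R[i]) :
  (forall j, mu.-integrable setT (EFin \o h j)) ->
  (forall x, f x * (g x)^* = \sum_(j <- s) z j * (h j x)%:C%C) ->
  L2dot mu f g = \sum_(j <- s) z j * (\int[mu]_x h j x)%:C%C.
Proof.
move=> hi fg; rewrite /L2dot; apply/eqP; rewrite eq_complex/= Re_lincomb Im_lincomb.
under eq_Rintegral do rewrite fg Re_lincomb.
under [X in _ && (X == _)]eq_Rintegral do rewrite fg Im_lincomb.
by rewrite !(Rintegral_lincomb _ _ hi).2 !eqxx.
Qed.

End ComplexIntegral.

Section ConjReal.
Variable R : realType.
Implicit Types (z w : R[i]) (x y : R).

Lemma conjM_real x z : (x%:C%C * z)^* = x%:C%C * z^*.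
Proof. by rewrite rmorphM/=; congr (_ * _); exact: conjc_real. Qed.

Lemma mul_conj_real z w x y :
  (z * x%:C%C) * (w * y%:C%C)^* = z * w^* * (x * y)%:C%C.
Proof. by rewrite [w * _]mulrC conjM_real rmorphM/=; ring. Qed.

End ConjReal.

Section Dot.
Variables (R : realType) (mu : {measure set borelQ2 -> \bar R}).
Hypothesis hmu : is_haar mu.
Variables (s : nat) (alpha : 'I_(2 ^ s) -> R[i]).
Local Notation N := (2 ^ s)%N.

Definition dil (k : int) : R := 2 `^ (- k%:~R / 2).

Lemma dil_gt0 k : 0 < dil k. Proof. exact: powR_gt0. Qed.

Lemma dil_sqr k : dil k * dil k * 2 ^ k = 1.
Proof.
rewrite /dil -powRD; last by rewrite pnatr_eq0 implybT.
rewrite -splitr -mulrNz powR_intmul// -expfzDr ?pnatr_eq0// addNr; exact: expr0z.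
Qed.

Lemma psi_sE (x : Q2) :
  psi_s alpha x = \sum_(k < N) alpha k * (haar R (x + k%:R / 2 ^+ s))%:C%C.
Proof. by apply: eq_bigr => k _; rewrite psi0E. Qed.

Lemma dilate_shiftE j (x : Q2) : dilate_shift (psi_s alpha) j x =
  \sum_(k < N) (dil j.1)%:C%C * alpha k * (haarf R j.1 (j.2 - k%:R / 2 ^+ s) x)%:C%C.
Proof.
rewrite /dilate_shift psi_sE mulr_sumr; apply: eq_bigr => k _.
by rewrite mulrA /haarf opprB addrA addrAC.
Qed.

(** Both functions are expanded in [haarf]. Different scales are orthogonal; at equal scales the
    squared factor [dil] cancels the measure of the ball. *)
Lemma L2dot_dilate_shift i j :
  L2dot mu (dilate_shift (psi_s alpha) i) (dilate_shift (psi_s alpha) j) =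
  (i.1 == j.1)%:R * corr alpha (i.2 - j.2).
Proof.
pose b (k : 'I_N) : Q2 := k%:R / 2 ^+ s.
rewrite (@L2dot_lincomb _ borelQ2 _ _ _ (index_enum ('I_N * 'I_N)%type)
  (fun p => (dil i.1)%:C%C * alpha p.1 * ((dil j.1)%:C%C * alpha p.2)^* )
  (fun p (x : Q2) => haarf R i.1 (i.2 - b p.1) x * haarf R j.1 (j.2 - b p.2) x)); first last.
- move=> x; rewrite !dilate_shiftE rmorph_sum/= big_distrlr/=.
  rewrite pair_big/=; apply: eq_bigr => p _.
  exact: mul_conj_real.
- by move=> p; exact: (haarf_dot hmu _ _ _ _).1.
under eq_bigr => p _ do rewrite (haarf_dot hmu _ _ _ _).2.
have [ij|_] := eqVneq i.1 j.1; last first.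
  by rewrite mul0r big1// => p _; rewrite mul0r mulr0.
rewrite mul1r /corr pair_big/=; apply: eq_bigr => p _.
rewrite mul1r ij conjM_real.
have -> : i.2 - b p.1 - (j.2 - b p.2) = i.2 - j.2 - b p.1 + b p.2.
  by move: (b p.1) (b p.2) => b1 b2; ring.
have e : (dil j.1)%:C%C * (dil j.1)%:C%C * (2 ^ j.1)%:C%C = 1 :> R[i].
  by rewrite -!rmorphM dil_sqr.
rewrite [(2 ^ j.1 * _)%:C%C]rmorphM /=.
move: e; move: ((dil j.1)%:C%C) ((2 ^ j.1)%:C%C) ((haar R _)%:C%C) => a c h e.
by rewrite -[RHS]mul1r -e; ring.
Qed.

Lemma uroot_expr (r : nat) (k : 'I_N) : uroot R s r ^+ k =
  (-1) ^+ k * cis (- (pi * ((2 * r + 1)%N%:R / 2 ^+ s) * (k : nat)%:R)).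
Proof.
rewrite [LHS]exprMn cisX mulNr; congr (_ * _); rewrite -exprM.
(* For [s = 0] the only index is [k = 0], where both signs are 1. *)
case: posnP => [s0|_]; last by rewrite mul1n.
by case: k => k /=; rewrite s0 expn0 ltnS leqn0 => /eqP ->.
Qed.

Lemma alpha_formula (gamma : 'I_N -> R[i]) :
  (forall k : 'I_N, alpha k = 2 ^- s * (-1) ^+ k * \sum_(r < N)
    gamma r * cis (- (pi * ((2 * r + 1)%N%:R / 2 ^+ s) * (k : nat)%:R))) <->
  (forall k : 'I_N, alpha k = N%:R^-1 * \sum_(r < N) gamma r * uroot R s r ^+ k).
Proof.
have e (k : 'I_N) : 2 ^- s * (-1) ^+ k * \sum_(r < N)
    gamma r * cis (- (pi * ((2 * r + 1)%N%:R / 2 ^+ s) * (k : nat)%:R)) =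
    N%:R^-1 * \sum_(r < N) gamma r * uroot R s r ^+ k.
  rewrite -mulrA [N%:R]natrX; congr (_ * _); rewrite mulr_sumr; apply: eq_bigr => r _.
  by rewrite uroot_expr mulrCA.
by split => a k; rewrite a e.
Qed.

(** At scale 0 the shifts [m / 2 ^+ s] are representatives in [I2]; their inner products with the
    unshifted function are the values of [corr] required by [dft_unit]. *)
Lemma corr_wavelet : is_wavelet mu (psi_s alpha) -> forall r, `|dft alpha r| = 1.
Proof.
move=> [[_ orth] _]; apply: dft_unit => m mN.
have I0 : I2 (0 : Q2) := I2_0.
have := orth (0, m%:R / 2 ^+ s) (0, 0) (I2_frac mN) I0.
rewrite L2dot_dilate_shift eqxx mul1r subr0 => ->.
rewrite xpair_eqE eqxx /=; congr (nat_of_bool _)%:R.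
apply/eqP/eqP => [m0|->]; last by rewrite mul0r.
have := Z2_0; rewrite -m0 => /Z2_nat_divX/dvdn_leq.
by case: (m) mN => // m' mN /(_ isT); rewrite leqNgt mN.
Qed.

End Dot.

(** * Totality *)

Lemma ball2_around (U : set Q2) x : open2 U -> U x ->
  exists k q, ball2 k (ratQ2 q) x /\ ball2 k (ratQ2 q) `<=` U.
Proof.
move=> oU /oU[r r0 rU].
have [n nr] : exists n : nat, (2 ^+ n)^-1 < r.
  exists (Num.bound r^-1); rewrite invf_plt ?posrE ?exprn_gt0//.
  rewrite (lt_trans (archi_boundP _)) ?invr_ge0 ?ltW//.
  by rewrite -natrX ltr_nat ltn_expl.
(* The centre parameter matters only modulo Z_2, so it can be rational; this makes the balls used
   countable in number. *)
have [q xq] := @norm2_rat_dense (2 ^ (- n%:Z) * x) 1 ltr01.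
have xB : ball2 (- n%:Z) (ratQ2 q) x by rewrite /ball2/= Z2E.
exists (- n%:Z), q; split=> // y yB; apply: rU => /=.
have -> : y - x = 2 ^+ n * (2 ^ (- n%:Z) * (y - x)).
  by rewrite mulrA exprnP -expfzDr ?Q2_2_neq0// subrr expr0z mul1r.
rewrite (le_lt_trans (norm2M_le _ _))// norm2_exp2.
apply: le_lt_trans nr; rewrite ler_piMr ?invr_ge0 ?exprn_ge0// -Z2E.
by have := Z2B yB xB; rewrite opprB addrA subrK mulrBr.
Qed.

(** The empty set is included so that the balls form a pi-system. *)
Definition balls : set (set Q2) := [set A | A = set0 \/ exists k b, A = ball2 k b].

Lemma balls_setI : setI_closed balls.
Proof.
have half k b k' b' : k <= k' -> balls (ball2 k b `&` ball2 k' b').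
  move=> kk'; have [[x [xB xB']]|BB'] := pselect (exists x, (ball2 k b `&` ball2 k' b') x).
    by right; exists k, b; apply/setIidPl; exact: ball2_sub xB xB'.
  by left; rewrite -subset0 => x ?; apply: BB'; exists x.
move=> A B [->|[k [b ->]]] [->|[k' [b' ->]]]; rewrite ?set0I ?setI0; try by left.
by have [|/ltW] := leP k k' => ?; [|rewrite setIC]; exact: half.
Qed.

(** An open set is the union of the balls with rational parameter that it contains, a countable
    union enumerated by [unpickle]. *)
Lemma borel_balls (A : set borelQ2) : measurable A -> <<s balls>> A.
Proof.
apply: smallest_sub => /=; first exact: smallest_sigma_algebra.
move=> U oU; pose F (p : int * rat) : set Q2 :=
  if `[< ball2 p.1 (ratQ2 p.2) `<=` U >] then ball2 p.1 (ratQ2 p.2) else set0.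
have -> : U = \bigcup_n (if unpickle n is Some p then F p else set0).
  apply/seteqP; split => [x Ux|x [n _]].
    have [k [q [xB BU]]] := ball2_around oU Ux.
    by exists (pickle (k, q)) => //; rewrite pickleK /F/=; case: asboolP.
  by case: unpickle => [p|]//; rewrite /F; case: asboolP => // + xB => /(_ _ xB).
apply: sigma_algebra_bigcup => n; case: unpickle => [p|]; last exact: sigma_algebra0.
rewrite /F; case: asboolP => _; last exact: sigma_algebra0.
by apply: sub_sigma_algebra; right; exists p.1, (ratQ2 p.2).
Qed.

Section Totality.
Variables (R : realType) (mu : {measure set borelQ2 -> \bar R}).
Hypothesis hmu : is_haar mu.
Variables (s : nat) (alpha : 'I_(2 ^ s) -> R[i]).
Hypothesis dft1 : forall r, `|dft alpha r| = 1.
Local Notation N := (2 ^ s)%N.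
Local Notation e := (dilate_shift (psi_s alpha)).
Local Notation D := [set j : int * Q2 | I2 j.2].
Local Notation adh := (@adherent _ borelQ2 R mu (int * Q2)%type D e).

Lemma L2_ball2 k b : L2 mu (fun x : borelQ2 => (\1_(ball2 k b) x)%:C%C : R[i]).
Proof. by apply: L2_indic; [exact: measurable_ball2|exact: measure_ball2_lty]. Qed.

Lemma L2_haarf k b : L2 mu (fun x : borelQ2 => (haarf R k b x)%:C%C).
Proof.
have -> : (fun x : borelQ2 => (haarf R k b x)%:C%C) = (fun x : borelQ2 =>
    (\1_(ball2 (k - 1) (b / 2)) x)%:C%C + (-1) * (\1_(ball2 (k - 1) ((b + 1) / 2)) x)%:C%C).
  by apply/funext => x; rewrite haarfE rmorphB mulN1r.
by apply: L2D; [|apply: L2Z]; exact: L2_ball2.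
Qed.

Lemma L2_dilate_shift j : L2 mu (e j : borelQ2 -> R[i]).
Proof.
have -> : e j = (fun x => \sum_(k < N)
    (dil R j.1)%:C%C * alpha k * (haarf R j.1 (j.2 - k%:R / 2 ^+ s) x)%:C%C).
  by apply/funext => x; exact: dilate_shiftE.
by apply: L2_sum => k; apply: L2Z; exact: L2_haarf.
Qed.

Let eL2 j : D j -> L2 mu (e j : borelQ2 -> R[i]).
Proof. by move=> _; exact: L2_dilate_shift. Qed.

Lemma psi_sD x z : Z2 z -> psi_s alpha (x + z) = (haar R z)%:C%C * psi_s alpha x.
Proof.
move=> Zz; rewrite !psi_sE mulr_sumr; apply: eq_bigr => k _.
by rewrite addrAC (haarD _ _ Zz) [(_ * _)%:C%C]rmorphM/=; ring.
Qed.

(** An arbitrary shift [b] differs from a representative [a] by an integer, which only multiplies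
    [psi_s] by the constant [haar R (a - b)]. *)
Lemma adherent_psi_s k b : adh (fun x => psi_s alpha (2 ^ k * x - b)).
Proof.
have [a Ia Zab] := I2_repr b.
have -> : (fun x => psi_s alpha (2 ^ k * x - b)) =
    (fun x => ((haar R (a - b))%:C%C / (dil R k)%:C%C) * e (k, a) x).
  apply/funext => x; rewrite /dilate_shift/= -[LHS]/(psi_s alpha (2 ^ k * x - b)).
  have -> : 2 ^ k * x - b = 2 ^ k * x - a + (a - b) by rewrite addrA subrK.
  rewrite psi_sD; last by rewrite -Z2N opprB.
  rewrite -mulrA; congr (_ * _); rewrite mulKf//.
  by rewrite (inj_eq (@complexI R) _ 0) gt_eqF// dil_gt0.
by apply: adherentZ => //; apply: adherent_gen.
Qed.

(** Grouping [corr] by [l] gives translates of [psi_s] weighted by the conjugate coefficients, and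
    [corr] equals [haar] by [corr_unit]. *)
Lemma haar_psi_s y : (haar R y)%:C%C =
  \sum_(l < N) (alpha l)^* * psi_s alpha (y - l%:R / 2 ^+ s).
Proof.
rewrite -haarN -(corr_unit _ dft1) /corr exchange_big; apply: eq_bigr => l _ /=.
rewrite psi_sE mulr_sumr; apply: eq_bigr => k _.
rewrite mulrCA mulrA; congr (_ * (_)%:C%C); rewrite -[LHS]haarN; congr (haar R _).
by rewrite !opprD !opprK addrAC.
Qed.

Lemma adherent_haarf k b : adh (fun x => (haarf R k b x)%:C%C).
Proof.
have -> : (fun x : borelQ2 => (haarf R k b x)%:C%C) = (fun x => \sum_(l < N)
    (alpha l)^* * psi_s alpha (2 ^ k * x - (b + l%:R / 2 ^+ s))).
  apply/funext => x; rewrite haar_psi_s; apply: eq_bigr => l _.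
  by rewrite opprD addrA.
by apply: adherent_sum => // l; apply: adherentZ => //; exact: adherent_psi_s.
Qed.

Lemma ball2_haar k b x : \1_(ball2 k b) x =
  (\1_(ball2 (k + 1) (2 * b)) x + haarf R (k + 1) (2 * b) x) / 2 :> R.
Proof.
rewrite !indic_ball2 -haar_half -Q2_scale_half addrK.
by rewrite [2 * b]mulrC mulfK ?Q2_2_neq0.
Qed.

Lemma adherent_ball2_tail n k b : exists2 g : Q2 -> R[i], adh g &
  exists b', forall x, (\1_(ball2 k b) x)%:C%C =
    g x + (2 ^- n)%:C%C * (\1_(ball2 (k + n%:Z) b') x)%:C%C.
Proof.
elim: n k b => [|n IH] k b.
  exists (fun=> 0); first exact: adherent0.
  by exists b => x; rewrite expr0 invr1 mul1r addr0 add0r.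
have [g ga [b' gE]] := IH (k + 1) (2 * b).
exists (fun x => (2^-1)%:C%C * (g x + (haarf R (k + 1) (2 * b) x)%:C%C)).
  by apply: adherentZ => //; apply: adherentD => //; exact: adherent_haarf.
exists b' => x; have -> : k + n.+1%:Z = k + 1 + n%:Z by lia.
rewrite ball2_haar exprS invfM [LHS]rmorphM [X in X * _ = _]rmorphD /= gE.
by rewrite [(2^-1 * _)%:C%C]rmorphM /=; ring.
Qed.

Lemma adherent_ball2 k b : adh (fun x => (\1_(ball2 k b) x)%:C%C).
Proof.
have [mB _] := (L2P _ _).1 (L2_ball2 k b).
apply: adherent_lim => // eps e0.
(* The squared norm of the tail is [2 ^ (k + n)] divided by the square of [2 ^ n]. *)
have [n ne] : exists n : nat, 2 ^ k / 2 ^+ n < eps.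
  have h0 : 0 < 2 ^ k / eps by rewrite divr_gt0 ?exprz_gt0.
  exists (Num.bound (2 ^ k / eps)); rewrite ltr_pdivrMr ?exprn_gt0//.
  rewrite mulrC -ltr_pdivrMr// (lt_trans (archi_boundP (ltW h0)))//.
  by rewrite -natrX ltr_nat ltn_expl.
have [g ga [b' gE]] := adherent_ball2_tail n k b; exists g => //.
have -> : (fun x => (\1_(ball2 k b) x)%:C%C - g x) =
    (fun x => (2 ^- n)%:C%C * (\1_(ball2 (k + n%:Z) b') x)%:C%C).
  by apply/funext => x; rewrite gE addrC addKr.
rewrite sqrintZ; last by have [] := (L2P _ _).1 (L2_ball2 (k + n%:Z) b').
rewrite sqrint_indic ?measure_ball2//; last exact: measurable_ball2.
rewrite sqrC_real -EFinM lte_fin; apply: le_lt_trans ne.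
rewrite expfzDr ?pnatr_eq0// -exprnP mulrCA ler_wpM2l ?exprz_ge0//.
by rewrite expr2 -mulrA mulVf ?mulr1// expf_neq0// pnatr_eq0.
Qed.

Lemma adherent_indic_lim (A : set borelQ2) (F : nat -> set borelQ2) :
  measurable A -> (mu A < +oo)%E -> (forall n, F n `<=` A) ->
  (forall x, A x -> exists n, forall m, (n <= m)%N -> F m x) ->
  (forall n, adh (fun x => (\1_(F n) x)%:C%C)) ->
  adh (fun x => (\1_A x)%:C%C).
Proof.
move=> mA A_fin FA AF Fa; apply: (adherent_dominated _ _ Fa) => //.
- exact: L2_indic.
- move=> x; apply: cvg_near_cst.
  have [Ax|nAx] := pselect (A x); last first.
    exists 0%N => // n _ /=; rewrite !indicE !memNset//; last by move/FA.
    by rewrite subrr /sqrC/= expr0n addr0.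
  have [n nF] := AF x Ax; exists n => // m /= nm.
  rewrite !indicE !mem_set//; last exact: nF.
  by rewrite subrr /sqrC/= expr0n addr0.
- move=> n x; rewrite -rmorphB !sqrC_real !indicE.
  have [FAx|nFx] := boolP (x \in F n); last by rewrite subr0.
  rewrite (_ : x \in A = true); last by apply/mem_set/(FA n); move: FAx; rewrite inE.
  by rewrite subrr expr0n expr1n.
Qed.

(** The pi-lambda argument runs inside a fixed ball, since increasing unions require finite
    measure. *)
Lemma adherent_indic_ball2 K (A : set borelQ2) : measurable A ->
  adh (fun x => (\1_(A `&` ball2 K 0) x)%:C%C).
Proof.
pose H := [set A : set Q2 | measurable (A : set borelQ2) /\
  adh (fun x => (\1_(A `&` ball2 K 0) x)%:C%C)].
suff HA : <<s balls>> `<=` H by move=> /borel_balls/HA[].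
have mK := measurable_ball2 K 0.
have adh0 : adh (fun x : Q2 => (\1_(set0 : set Q2) x)%:C%C).
  rewrite [X in adherent _ _ _ X](_ : _ = (fun=> 0)); first exact: adherent0.
  by apply/funext => x; rewrite indicE memNset.
apply: lambda_system_subset => //; first exact: balls_setI.
- split => //.
  + by split => //; rewrite setTI; exact: adherent_ball2.
  + move=> A' B' BA [mA Aa] [mB Ba]; split; first exact: measurableD.
    have -> : (fun x => (\1_((A' `\` B') `&` ball2 K 0) x)%:C%C : R[i]) = (fun x =>
        (\1_(A' `&` ball2 K 0) x)%:C%C + (-1) * (\1_(B' `&` ball2 K 0) x)%:C%C).
      apply/funext => x; rewrite mulN1r -rmorphB; congr (_%:C%C).
      rewrite !indicE setDE !in_setI in_setC.
      have := BA x; have [xB|xB] := boolP (x \in B') => h; last first.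
        by rewrite /= andbT subr0.
      rewrite (_ : x \in A' = true) ?subrr//; apply/mem_set/h.
      by move: xB; rewrite inE.
    by apply: adherentD => //; exact: adherentZ.
  + move=> F ndF HF; have mF n : measurable (F n : set borelQ2) := (HF n).1.
    have mU : measurable (\bigcup_n F n : set borelQ2) by exact: bigcup_measurable.
    split => //; apply: (@adherent_indic_lim _ (fun n => F n `&` ball2 K 0)).
    * exact: measurableI.
    * apply: le_lt_trans (measure_ball2_lty hmu K 0).
      by apply: le_measure; rewrite ?inE//; exact: measurableI.
    * by move=> n; apply: setSI; exact: bigcup_sup.
    * move=> x [[n _ Fx] Bx]; exists n => m nm; split => //.
      by have /subsetPset := ndF _ _ nm; exact.
    * by move=> n; exact: (HF n).2.
- move=> A' [->|[k [b ->]]]; split => //.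
  + by rewrite set0I.
  + exact: measurable_ball2.
  + have [->|[k' [b' ->]]] := balls_setI (or_intror (ex_intro _ k (ex_intro _ b erefl)))
      (or_intror (ex_intro _ K (ex_intro _ 0 erefl))).
      exact: adh0.
    exact: adherent_ball2.
Qed.

(** The balls [ball2 n 0] exhaust Q_2, so the traces of [A] on them approximate [A]. *)
Lemma adherent_indic (A : set borelQ2) : measurable A -> (mu A < +oo)%E ->
  adh (fun x => (\1_A x)%:C%C).
Proof.
move=> mA A_fin; apply: (@adherent_indic_lim _ (fun n => A `&` ball2 n%:Z 0)) => //.
- move=> x Ax; have [n Zx] := Z2_scale x; exists n => m nm; split => //.
  rewrite /ball2/= subr0 -exprnP -(subnK nm) exprD -mulrA.
  by rewrite Z2M ?Z2X ?(Z2_nat 2).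
- by move=> n; exact: adherent_indic_ball2.
Qed.

Lemma total_dilate_shift : total_system mu D e.
Proof.
by apply: adherent_total => // f fL2; apply: adherent_L2 => //; exact: adherent_indic.
Qed.

(** The correlation is [haar R (a - b)], which vanishes unless [a - b] is integral, and then the two
    representatives coincide. *)
Lemma orthonormal_dilate_shift : orthonormal_system mu D e.
Proof.
split => [j _|[k a] [l b] /= Ia Ib]; first exact: L2_dilate_shift.
rewrite L2dot_dilate_shift// corr_unit// xpair_eqE /=.
have [<-|ab] := eqVneq a b; first by rewrite subrr haar0 andbT mulr1.
rewrite andbF haar_out ?mulr0//.
by apply: contraNN ab => Zab; apply/eqP/(I2_uniq Ia Ib).
Qed.

End Totality.

Theorem theorem4 (R : realType) (mu : {measure set borelQ2 -> \bar R})
    (hmu : is_haar mu) (s : nat) (alpha : 'I_(2 ^ s) -> R[i]) :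
  is_wavelet mu (psi_s alpha) <->
  exists gamma : 'I_(2 ^ s) -> R[i],
    (forall r, `|gamma r| = 1) /\
    forall k : 'I_(2 ^ s),
      alpha k = 2 ^- s * (-1) ^+ k *
        \sum_(r < 2 ^ s)
          gamma r * cis (- (pi * ((2 * r + 1)%N%:R / 2 ^+ s) * (k : nat)%:R)).
Proof.
split=> [wav|[gamma [gamma1 /alpha_formula alphaE]]].
  exists (dft alpha); split; first exact: (corr_wavelet hmu).
  by apply/alpha_formula => k; exact: dft_inv.
have dft1 r : `|dft alpha r| = 1 by rewrite (dft_of alphaE).
by split; [exact: orthonormal_dilate_shift|exact: total_dilate_shift].
Qed.
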